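(* For every $n\geq 1$ there exists a bijection $\Psi:\mathcal{B}_n\to\mathcal{O}_n$ such that for every $\pi\in\mathcal{B}_n$, $$\mathsf{des}(\pi)=\widetilde{\mathsf{exc}}(\Psi(\pi))\qquad\text{and}\qquad \mathrm{PEAK}(\pi)=\mathsf{cPEAK}(\Psi(\pi)).$$ In particular $\sum_{\pi\in\mathcal{B}_n}t^{\mathsf{des}(\pi)}=\sum_{\sigma\in\mathcal{O}_n}t^{\widetilde{\mathsf{exc}}(\sigma)}$.
   Context: $\mathfrak{S}_n$ is the set of permutations of $[n]=\{1,\dots,n\}$, written in one-line notation $\pi=\pi_1\cdots\pi_n$ with $\pi_i=\pi(i)$, or as a product of disjoint cycles. $\mathsf{asc}(\pi)=|\{i\in[n-1]:\pi_i<\pi_{i+1}\}|$, $\mathsf{des}(\pi)=|\{i\in[n-1]:\pi_i>\pi_{i+1}\}|$. A ballot permutation is a $\pi\in\mathfrak{S}_n$ such that every prefix $\pi_1\cdots\pi_i$ has at most as many descents as ascents; $\mathcal{B}_n$ is the set of ballot permutations in $\mathfrak{S}_n$. $\mathcal{O}_n$ is the set of permutations in $\mathfrak{S}_n$ all of whose cycles have odd length. For a cycle $C=(c_1c_2\cdots c_k)$, $\mathsf{casc}(C)=|\{i\in[k]:c_i<c_{i+1}\}|$ with $c_{k+1}=c_1$, and $\mathsf{cdes}(C)=k-\mathsf{casc}(C)$; $\widetilde{\mathsf{exc}}(\sigma)=\sum_C\min(\mathsf{casc}(C),\mathsf{cdes}(C))$, summed over all cycles $C$ of $\sigma$ (including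 fixed points). A value $k$ is a peak of $\pi$ if $1<\pi^{-1}(k)=\ell<n$ and $\pi(\ell-1)<k>\pi(\ell+1)$; then $\pi(\ell-1),\pi(\ell+1)$ are its neighbors. A value $k$ is a cyclic peak of $\sigma$ if $\sigma^{-1}(k)<k>\sigma(k)$; its cyclic neighbors are $\sigma^{-1}(k)$ and $\sigma(k)$. $\mathrm{PEAK}(\pi)$ is the set of pairs $(b,\{a,c\})$ with $b$ a peak of $\pi$ and $a,c$ its neighbors; $\mathsf{cPEAK}(\sigma)$ is the set of pairs $(b,\{a,c\})$ with $b$ a cyclic peak of $\sigma$ and $a,c$ its cyclic neighbors. *)

(* Defs.v *)
(* Permutations of [n] are modelled as {perm 'I_n};
   the value k in {1..n} of the paper corresponds to the ordinal k-1.
   This shift is order preserving, so all statistics are unchanged. *)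
From mathcomp Require Import all_boot all_order all_algebra all_fingroup.
Set Implicit Arguments.
Unset Strict Implicit.
Unset Printing Implicit Defensive.

Definition oneline n (s : {perm 'I_n}) : seq nat := [seq val (s i) | i <- enum 'I_n].

Definition asc_seq (w : seq nat) : nat :=
  \sum_(i < (size w).-1) (nth 0 w i < nth 0 w i.+1).
Definition des_seq (w : seq nat) : nat :=
  \sum_(i < (size w).-1) (nth 0 w i > nth 0 w i.+1).

Definition asc n (s : {perm 'I_n}) := asc_seq (oneline s).
Definition des n (s : {perm 'I_n}) := des_seq (oneline s).

Definition ballot n (s : {perm 'I_n}) : bool :=
  [forall i : 'I_n.+1, des_seq (take i (oneline s)) <= asc_seq (take i (oneline s))].

Definition ballot_set n : {set {perm 'I_n}} := [set s | ballot s].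

Definition odd_cycles n (s : {perm 'I_n}) : bool :=
  [forall C in porbits s, odd #|C|].

Definition odd_set n : {set {perm 'I_n}} := [set s | odd_cycles s].

Definition casc n (s : {perm 'I_n}) (C : {set 'I_n}) : nat :=
  #|[set c in C | c < s c]|.
Definition cdes n (s : {perm 'I_n}) (C : {set 'I_n}) : nat := #|C| - casc s C.

Definition exct n (s : {perm 'I_n}) : nat :=
  \sum_(C in porbits s) minn (casc s C) (cdes s C).

Definition PEAK n (s : {perm 'I_n}) : {set 'I_n * {set 'I_n}} :=
  [set x | [exists i : 'I_n, [exists j : 'I_n, [exists k : 'I_n,
     [&& val j == (val i).+1, val k == (val j).+1,
         s i < s j, s k < s j & x == (s j, [set s i; s k])]]]]].

Definition cPEAK n (s : {perm 'I_n}) : {set 'I_n * {set 'I_n}} :=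
  [set x | [exists b : 'I_n,
     [&& (s^-1)%g b < b, s b < b & x == (b, [set (s^-1)%g b; s b])]]].

(* Main.v *)
(* By Moebius inversion over sets of peaks it suffices to compare, for each
   set T of pairs (b, {a, c}), the generating functions of the permutations
   whose peak set contains T, on words and on cycles.  The letters of a word
   are then joined by steps: 0 along an edge {b, a} or {b, c} of T, otherwise
   +1 for an ascent and -1 for a descent; a word is ballot iff its partial sums
   stay nonnegative, and words may be cut at nonzero steps only.

   Let B be the set function summing t^des over such ballot words on a set of
   letters.  For a fixed word, the sum over all its cuts into a ballot word and
   a reversed ballot word, with the sign (-1)^(number of pieces on the right),
   telescopes to 0 after multiplication by 1 + t, because the summand of a cut
   is a difference of two values of (-t)^(-height).  This gives the convolution
   inverse of B.  Pointing the left factor at a letter x and summing over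
   rotations, the same telescoping leaves only the two steps around the minimum
   of the closed path, so that B = sum over S containing x of K_S B_(U - S),
   where K_S = sum over the cycles on S of t^min(casc, cdes) if the number of
   nonzero steps is odd; the even cycles cancel against their reversals.  The
   permutations with odd cycles obey the same recursion. *)
Require Import Defs.
From mathcomp Require Import all_boot all_order all_algebra all_fingroup.
From mathcomp Require Import zify ring.
Set Implicit Arguments.
Unset Strict Implicit.
Unset Printing Implicit Defensive.
Import Order.TTheory GRing.Theory Num.Theory.
Local Open Scope ring_scope.

(** * Paths with steps 1, -1 and 0 *)

Definition sumz (e : seq int) : int := \sum_(a <- e) a.

Fixpoint stays (h : int) (e : seq int) : bool :=
  (0 <= h) && (if e is a :: e' then stays (h + a) e' else true).

(** Every suffix has nonpositive sum, so the path ends at its minimum. Read backwards with negated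
    steps it stays nonnegative: these are the reversed ballot paths. *)
Fixpoint low (e : seq int) : bool :=
  if e is a :: e' then (sumz (a :: e') <= 0) && low e' else true.

Fixpoint minz (e : seq int) : int :=
  if e is a :: e' then Num.min 0 (a + minz e') else 0.

Definition unit_step (a : int) := a \in [:: 1; -1; 0].

Definition ups (e : seq int) := count_mem 1 e.
Definition downs (e : seq int) := count_mem (-1) e.

Lemma sumz_nil : sumz [::] = 0. Proof. by rewrite /sumz big_nil. Qed.
Lemma sumz_cons a e : sumz (a :: e) = a + sumz e.
Proof. by rewrite /sumz big_cons. Qed.
Lemma sumz_cat e1 e2 : sumz (e1 ++ e2) = sumz e1 + sumz e2.
Proof. by rewrite /sumz big_cat. Qed.

Lemma stays_cat h e1 e2 : stays h (e1 ++ e2) = stays h e1 && stays (h + sumz e1) e2.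
Proof.
elim: e1 h => [|a e1 IH] h /=.
  by rewrite sumz_nil addr0; case: e2 => /= [|b e2]; case: (0 <= h).
by rewrite IH sumz_cons addrA andbA.
Qed.

Lemma low_sumz e : low e -> sumz e <= 0.
Proof. by case: e => [|a e] /=; rewrite ?sumz_nil // => /andP[]. Qed.

Lemma stays_minz h e : stays h e = (0 <= h + minz e).
Proof. by elim: e h => [|a e IH] h //=; rewrite ?IH; lia. Qed.

Lemma sumz_count e : all unit_step e -> sumz e = (ups e)%:Z - (downs e)%:Z.
Proof.
elim: e => [|a e IH] /=; first by rewrite sumz_nil.
rewrite sumz_cons => /andP[ua /IH ->]; move: ua.
by rewrite /unit_step !inE => /or3P[] /eqP->; rewrite /ups /downs /=; lia.
Qed.

(** A cut counts when the part before it ends at a minimum and the part after it never falls below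
    its own start. The offset [r] is the height of the start above a minimum reached earlier; it
    makes a recursion on the path possible. *)
Definition record_cuts (V : nmodType) (c r : int) (e : seq int) (g : int -> V) : V :=
  \sum_(0 <= j < size e)
    if [&& nth 0 e j == c, low (take j e), r + sumz (take j e) <= 0
         & stays 0 (drop j.+1 e)] then g (sumz (drop j.+1 e)) else 0.

(** After a step [a] the height above the running minimum becomes [max 0 (r + a)]. *)
Lemma record_cuts_cons (V : nmodType) c r a e (g : int -> V) : 0 <= r ->
  record_cuts c r (a :: e) g =
  (if [&& a == c, r == 0 & stays 0 e] then g (sumz e) else 0)
  + record_cuts c (Num.max 0 (r + a)) e g.
Proof.
move=> r0; rewrite /record_cuts big_nat_recl //= sumz_nil addr0 drop0.
congr (_ + _); first by have -> : (r <= 0) = (r == 0) by lia.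
apply: eq_bigr => j _; rewrite sumz_cons; congr (if _ then _ else _).
case: (nth 0 e j == c) => //=; case lowe: (low _); rewrite ?andbF //= andbT.
have := low_sumz lowe; case: (stays _ _); rewrite ?andbF // !andbT; lia.
Qed.

Lemma minz_le0 e : minz e <= 0.
Proof. by case: e => //= a e; rewrite ge_min lexx. Qed.

Lemma minz_le_sumz e : minz e <= sumz e.
Proof. by elim: e => [|a e IH] /=; rewrite ?sumz_nil // sumz_cons; lia. Qed.

(** At most one up-step qualifies: the last departure from the global minimum. It exists if the path
    ends above its minimum, and counts if this minimum is at most [- r]. *)
Lemma record_ups (V : nmodType) r e (g : int -> V) : all unit_step e -> 0 <= r ->
  record_cuts 1 r e g =
  if (minz e <= - r) && (minz e < sumz e) then g (sumz e - minz e - 1) else 0.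
Proof.
elim: e r => [|a e IH] r /=.
  by move=> _ r0; rewrite /record_cuts big_nil sumz_nil ltxx andbF.
case/andP=> ua ue r0; rewrite record_cuts_cons // IH ?le_max ?lexx //.
rewrite sumz_cons stays_minz add0r.
have m0 := minz_le0 e; have ms := minz_le_sumz e.
move: ua; rewrite /unit_step !inE => /or3P[] /eqP->; rewrite ?eqxx /=.
- have [mz|mz] := eqVneq (minz e) 0.
    have [rz|rz] := eqVneq r 0; rewrite mz ?rz /=.
      have -> : Num.min 0 (1 + 0 : int) < 1 + sumz e by lia.
      by rewrite addr0; congr g; lia.
    have -> : (0 <= - Num.max 0 (r + 1 : int)) = false by lia.
    have -> : (Num.min 0 (1 + 0 : int) <= - r) = false by lia.
    by rewrite addr0.
  have -> : (0 <= minz e) = false by lia.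
  rewrite andbF add0r.
  have -> : (minz e <= - Num.max 0 (r + 1)) && (minz e < sumz e) =
    (Num.min 0 (1 + minz e) <= - r) && (Num.min 0 (1 + minz e) < 1 + sumz e) by lia.
  by case: ifP => // ?; congr g; lia.
- rewrite /= add0r.
  have -> : (minz e <= - Num.max 0 (r - 1)) && (minz e < sumz e) =
    (Num.min 0 (-1 + minz e) <= - r) && (Num.min 0 (-1 + minz e) < -1 + sumz e) by lia.
  by case: ifP => // ?; congr g; lia.
- rewrite /= !add0r addr0 max_r // min_r //; case: ifP.
Qed.

(** At most one down-step qualifies: the first arrival at the global minimum, which has to lie
    strictly below [- r]. *)
Lemma record_downs (V : nmodType) r e (g : int -> V) : all unit_step e -> 0 <= r ->
  record_cuts (-1) r e g = if minz e < - r then g (sumz e - minz e) else 0.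
Proof.
elim: e r => [|a e IH] r /=.
  move=> _ r0; rewrite /record_cuts big_nil.
  by have -> : (0 < - r) = false by lia.
case/andP=> ua ue r0; rewrite record_cuts_cons // IH ?le_max ?lexx //.
rewrite sumz_cons stays_minz add0r.
have m0 := minz_le0 e; have ms := minz_le_sumz e.
move: ua; rewrite /unit_step !inE => /or3P[] /eqP->; rewrite ?eqxx /=.
- rewrite /= add0r.
  have -> : (minz e < - Num.max 0 (r + 1)) = (Num.min 0 (1 + minz e) < - r) by lia.
  by case: ifP => // ?; congr g; lia.
- case: ifP => c1.
    have -> : (minz e < - Num.max 0 (r - 1)) = false by lia.
    have -> : Num.min 0 (-1 + minz e) < - r by lia.
    by rewrite addr0; congr g; lia.
  have -> : (minz e < - Num.max 0 (r - 1)) = (Num.min 0 (-1 + minz e) < - r) by lia.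
  by rewrite add0r; case: ifP => // _; congr g; lia.
- by rewrite /= !add0r addr0 max_r // min_r.
Qed.

(** * Weights of paths and telescoping sums over cuts *)

Section Weights.
Variables (F : fieldType) (t : F).
Hypotheses (t_neq0 : t != 0) (t1_neq0 : 1 + t != 0).
Let y : F := - t.

Definition step_mul (a : int) : F := if a == 1 then y else if a == -1 then -1 else 1.
Definition theta (e : seq int) : F := \prod_(a <- e) step_mul a.
Definition dwt (e : seq int) : F := t ^+ downs e.

Let y_neq0 : y != 0. Proof. by rewrite oppr_eq0. Qed.

Lemma theta_cons a e : theta (a :: e) = step_mul a * theta e.
Proof. by rewrite /theta big_cons. Qed.
Lemma theta_cat e1 e2 : theta (e1 ++ e2) = theta e1 * theta e2.
Proof. by rewrite /theta big_cat. Qed.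

Lemma dwt_cons a e : dwt (a :: e) = (if a == -1 then t else 1) * dwt e.
Proof. by rewrite /dwt /downs /= exprD; case: (a == -1); rewrite ?expr1 ?expr0. Qed.
Lemma dwt_cat e1 e2 : dwt (e1 ++ e2) = dwt e1 * dwt e2.
Proof. by rewrite /dwt /downs count_cat exprD. Qed.

(** The weights of left and right parts differ only by a power of [y] given by the height gained,
    which is what makes sums over cuts telescope. *)
Lemma dwt_theta e : all unit_step e -> dwt e = theta e * y ^ (- sumz e).
Proof.
elim: e => [|a e IH] /=.
  by rewrite sumz_nil /theta big_nil oppr0 expr0z mulr1.
case/andP=> ua /IH {}IH; rewrite dwt_cons theta_cons sumz_cons IH opprD expfzDr //.
move: ua; rewrite /unit_step !inE => /or3P[] /eqP-> /=; rewrite /step_mul /=.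
- have -> : y ^ (-1) = y^-1 by [].
  by field.
- have -> : y ^ (- (-1)) = y by rewrite opprK expr1z.
  by rewrite /y; ring.
- by rewrite oppr0 expr0z; ring.
Qed.

Lemma theta_count e : theta e = y ^+ ups e * (-1) ^+ downs e.
Proof.
elim: e => [|a e IH]; first by rewrite /theta big_nil mulr1.
rewrite theta_cons IH /ups /downs /step_mul /= !exprD.
case: eqP => [->|_]; first by rewrite /= expr1 expr0; ring.
by case: eqP => _; rewrite /= ?expr1 ?expr0; ring.
Qed.

(* The signed sum over the cuts of a word with steps [e] when the part before
   the cut starts at height [h]; an empty right part is allowed, an empty left
   part is not. *)
Fixpoint cutsum (h : int) (e : seq int) : F :=
  if e is a :: e' then
    if 0 <= h then
      (if a == -1 then t else 1) * cutsum (h + a) e'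
      - (if (a != 0) && low e' then theta e' else 0)
    else 0
  else if 0 <= h then 1 else 0.

Lemma cutsum_lt0 h e : h < 0 -> cutsum h e = 0.
Proof. by case: e => /= [|a e]; rewrite ltNge => /negbTE->. Qed.

(** Multiplied by [1 - y], which is [1 + t], the sum over cuts telescopes to its two extreme powers
    of [y]. If the path is not [low], the contributions cancel entirely. *)
Lemma cutsum_closed h e : all unit_step e -> 0 <= h ->
  (1 - y) * cutsum h e =
  if low e then theta e * (1 - y ^ (h + 1 - Num.max 0 (h + sumz e))) else 0.
Proof.
elim: e h => [|a e IH] h /=.
  move=> _ h0; rewrite h0 sumz_nil /theta big_nil addr0 max_r //.
  by have -> : h + 1 - h = 1 :> int by [lia]; rewrite expr1z; ring.
case/andP=> ua ue h0; rewrite h0 theta_cons sumz_cons /step_mul.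
have yS z : y ^ (z + 1) = y * y ^ z by rewrite expfzDr // expr1z mulrC.
move: ua; rewrite /unit_step !inE => /or3P[] /eqP-> /=.
- have h1 : 0 <= h + 1 by lia.
  rewrite mul1r mulrBr (IH _ ue h1) addrA.
  case lowe: (low e); last by rewrite andbF mulr0 subr0.
  have := low_sumz lowe; rewrite andbT => s0.
  have -> : h + 1 + 1 - Num.max 0 (h + 1 + sumz e)
     = (h + 1 - Num.max 0 (h + 1 + sumz e)) + 1 by ring.
  rewrite yS; case: (leP (1 + sumz e) 0) => s1; first by ring.
  have -> : h + 1 - Num.max 0 (h + 1 + sumz e) = 0 by lia.
  by rewrite expr0z; ring.
- rewrite mulrBr mulrCA.
  case lowe: (low e); last first.
    rewrite andbF mulr0 subr0.
    have [h1|h1] := leP 0 (h - 1); first by rewrite IH // lowe mulr0.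
    by rewrite cutsum_lt0 // !mulr0.
  have := low_sumz lowe; rewrite andbT => s0.
  have -> : (-1 + sumz e <= 0) by lia.
  have [h1|h1] := leP 0 (h - 1).
    rewrite IH // lowe addrA.
    have -> : h + 1 - Num.max 0 (h - 1 + sumz e)
       = (h - 1 + 1 - Num.max 0 (h - 1 + sumz e)) + 1 by ring.
    by rewrite yS /y; ring.
  (* A down-step from height 0 rules out every longer left part, so only the cut at this step
     remains. *)
  rewrite cutsum_lt0 //; have -> : h = 0 by lia.
  have -> : 0 + 1 - Num.max 0 (0 + (-1 + sumz e)) = 1 by lia.
  by rewrite expr1z; ring.
- rewrite mul1r addr0 subr0 IH // mul1r add0r.
  by case lowe: (low e); rewrite ?andbF // (low_sumz lowe).
Qed.

Lemma cutsumE h e : cutsum h e =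
  (if stays h e then dwt e else 0)
  - \sum_(0 <= j < size e)
      if [&& nth 0 e j != 0, stays h (take j e) & low (drop j.+1 e)]
      then dwt (take j e) * theta (drop j.+1 e) else 0.
Proof.
elim: e h => [|a e IH] h /=; first by rewrite big_nil subr0 andbT.
rewrite big_nat_recl //= andbT; case: (boolP (0 <= h)) => h0 /=; last first.
  by rewrite andbF big1 => [|j _]; rewrite ?andbF // addr0 subr0.
rewrite IH dwt_cons drop0 mulrBr mulr_sumr [dwt [::]]expr0 mul1r.
rewrite [X in _ = _ - X]addrC opprD addrA; congr (_ - _ - _).
  by case: (stays _ _); rewrite ?mulr0.
apply: eq_bigr => j _; rewrite dwt_cons.
by case: ([&& _, _ & _]); rewrite ?mulr0 ?mulrA.
Qed.

(** For an odd number of nonzero steps this is [t] to the smaller of the two counts. For an even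
    number it changes sign when ups and downs are exchanged. *)
Definition kappa (e : seq int) : F :=
  if (downs e < ups e)%N then t ^+ downs e
  else if (ups e < downs e)%N then - (-1) ^+ (ups e + downs e) * t ^+ ups e
  else 0.

(* Closing up a word into a cycle: for each cut of the cycle, the right record
   of the path is paired with all the cuts counted by [cutsum]; only the two
   edges around the global minimum of the path survive. *)
Lemma cyclic_cutsum e : all unit_step e ->
  \sum_(0 <= j < size e)
     (if (nth 0 e j != 0) && stays 0 (drop j.+1 e) then
        dwt (drop j.+1 e) * cutsum (sumz (drop j.+1 e)) (take j e) else 0)
  = kappa e.
Proof.
move=> ue; apply: (@mulfI _ (1 - y)); first by rewrite /y opprK.
pose s := sumz e.
(* [gu] and [gd] are [1 - y] times the summand at an up-step and at a down-step, as functions of the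
   height [F'] gained after the cut. *)
pose gu F' := theta e * (y^-1 * (y ^ (- F') - y ^ (1 - Num.max 0 (s - 1)))).
pose gd F' := - (theta e * (y ^ (- F') - y ^ (1 - Num.max 0 (s + 1)))).
have m0 := minz_le0 e; have ms := minz_le_sumz e.
transitivity (record_cuts 1 0 e gu + record_cuts (-1) 0 e gd).
  rewrite /record_cuts -big_split mulr_sumr /=; apply: eq_big_nat => j /andP[_ lj].
  set c := nth 0 e j; set e1 := take j e; set f := drop j.+1 e.
  have De : e = e1 ++ c :: f by rewrite -drop_nth // cat_take_drop.
  have : all unit_step (e1 ++ c :: f) by rewrite -De.
  rewrite all_cat /= => /and3P[u1 uc uf].
  have Ds : s = sumz e1 + c + sumz f by rewrite /s De sumz_cat sumz_cons addrA.
  have Dt : theta e = step_mul c * (theta e1 * theta f).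
    by rewrite De theta_cat theta_cons mulrCA.
  rewrite add0r; case sf: (stays 0 f); rewrite ?(andbT, andbF); last by rewrite addr0 mulr0.
  case lo: (low e1); last first.
    rewrite ?(andbF, andFb) addr0; case: ifP => _; rewrite ?mulr0 // mulrCA cutsum_closed //.
      by rewrite lo mulr0.
    by move: sf; rewrite stays_minz; have := minz_le_sumz f; lia.
  have F0 : 0 <= sumz f by move: sf; rewrite stays_minz; have := minz_le_sumz f; lia.
  rewrite (low_sumz lo) !andbT (fun_if ( *%R (1 - y))) mulr0 mulrCA cutsum_closed // lo.
  rewrite dwt_theta //.
  have yD (a b : int) : y ^ (a + b) = y ^ a * y ^ b by rewrite expfzDr.
  have yV (a : int) : y ^ (- a) * y ^ a = 1 by rewrite -yD addNr expr0z.
  move: uc; rewrite /unit_step !inE => /or3P[] /eqP Dc; rewrite Dc /=.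
  - rewrite addr0 /gu Dt Dc /step_mul /=.
    have -> : s - 1 = sumz f + sumz e1 by rewrite Ds Dc; ring.
    set M := Num.max _ _.
    rewrite (_ : y ^ (1 - M) = y ^ (- sumz f) * y ^ (sumz f + 1 - M)); last first.
      by rewrite -yD; congr (y ^ _); ring.
    by field.
  - rewrite add0r /gd Dt Dc /step_mul /=.
    have -> : s + 1 = sumz f + sumz e1 by rewrite Ds Dc; ring.
    set M := Num.max _ _.
    rewrite (_ : y ^ (1 - M) = y ^ (- sumz f) * y ^ (sumz f + 1 - M)); last first.
      by rewrite -yD; congr (y ^ _); ring.
    by ring.
  - by rewrite addr0.
rewrite record_ups // record_downs // oppr0 m0 /= -/s /gu /gd theta_count /kappa.
have Ds : s = (ups e)%:Z - (downs e)%:Z by apply: sumz_count.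
move: ms; rewrite -/s => ms; clear gu gd; clearbody s.
move: (ups e) (downs e) (minz e) s Ds m0 ms => a d m s' Ds m0 ms.
have yD (p q : int) : y ^ (p + q) = y ^ p * y ^ q by rewrite expfzDr.
have -> : y ^ (- (s' - m - 1)) = y * y ^ (m - s').
  by rewrite -{2}[y]expr1z -yD; congr (y ^ _); ring.
have -> : y ^ (- (s' - m)) = y ^ (m - s') by congr (y ^ _); ring.
have tE k : t ^+ k = (-1) ^+ k * y ^+ k by rewrite -exprMn /y mulN1r opprK.
have sqr1 k : (-1) ^+ k * (-1) ^+ k = 1 :> F.
  by rewrite -exprMn mulrNN mulr1 expr1n.
(* The up-step exists iff [m < s'], the down-step iff [m < 0]. If both exist, the powers involving
   [m] cancel; the sign of [s'] selects the case of [kappa]. *)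
have [s1|s1] := ltP 0 s'.
  have -> : (d < a)%N by lia.
  have -> : m < s' by lia.
  have -> : 1 - Num.max 0 (s' - 1) = 2 - s' by lia.
  have -> : 1 - Num.max 0 (s' + 1) = - s' by lia.
  have -> : y ^ (2 - s') = y * y * y ^ (- s').
    by rewrite yD; congr (_ * _); rewrite -exprnP expr2.
  have ya : y ^+ a * y ^ (- s') = y ^+ d.
    by rewrite !exprnP -yD; congr (y ^ _); rewrite Ds; ring.
  rewrite tE -ya; case: ltP => m1.
    by field.
  have -> : m = 0 by lia.
  by rewrite add0r; field.
have -> : (d < a)%N = false by lia.
have -> : 1 - Num.max 0 (s' - 1) = 1 by lia.
rewrite expr1z.
have [s0|s0] := ltP s' 0.
  have -> : (a < d)%N by lia.
  have -> : m < 0 by lia.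
  have -> : 1 - Num.max 0 (s' + 1) = 1 by lia.
  rewrite expr1z tE exprD; case: ltP => m1.
    rewrite (_ : - (_ * _) * _ = - ((-1) ^+ a * (-1) ^+ a) * ((-1) ^+ d * y ^+ a)); last by ring.
    by rewrite sqr1; field.
  have -> : m - s' = 0 by lia.
  rewrite expr0z (_ : - (_ * _) * _ = - ((-1) ^+ a * (-1) ^+ a) * ((-1) ^+ d * y ^+ a)); last by ring.
  by rewrite sqr1; ring.
have -> : (a < d)%N = false by lia.
have -> : s' = 0 by lia.
case: ltP => m1; last by rewrite addr0 mulr0.
by rewrite /Num.max /= expr0z; field.
Qed.
End Weights.

(** * Words and cycles with prescribed peaks *)

Definition adj (A : Type) (w : seq A) : seq (A * A) :=
  if w is x :: w' then pairmap pair x w' else [::].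
Definition cadj (A : Type) (w : seq A) : seq (A * A) :=
  if w is x :: w' then pairmap pair x (rcons w' x) else [::].

Section Adjacency.
Variable A : eqType.
Implicit Types w u v : seq A.

Lemma mem_pairmap_pair (a b x : A) w :
  (a, b) \in pairmap pair x w -> (a \in x :: w) /\ (b \in w).
Proof.
elim: w x => //= c w IH x; rewrite inE => /orP[/eqP[-> ->]|/IH[aw bw]].
  by rewrite eqxx mem_head.
by rewrite aw inE bw !orbT.
Qed.

Lemma mem_adj a b w : (a, b) \in adj w -> (a \in w) /\ (b \in w).
Proof. by case: w => //= x w /mem_pairmap_pair[aw bw]; rewrite aw inE bw orbT. Qed.

Lemma mem_adj_neq_head a b x w : uniq (x :: w) -> (a, b) \in adj (x :: w) -> b != x.
Proof.
by move=> /= /andP[xw _] /mem_pairmap_pair[_]; apply: contraTneq => ->.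
Qed.

Lemma mem_adj_neq_last a b x w : uniq (x :: w) -> (a, b) \in adj (x :: w) -> a != last x w.
Proof.
elim: w x => //= y w IH x /andP[xw uw]; rewrite inE => /orP[/eqP[-> _]|]; last exact: IH.
by apply: contraNneq xw => ->; exact: mem_last.
Qed.

Lemma adj_cat a u b v :
  adj ((a :: u) ++ b :: v) = adj (a :: u) ++ (last a u, b) :: adj (b :: v).
Proof. by rewrite /= pairmap_cat. Qed.

Lemma cadj_rcons a u : cadj (a :: u) = rcons (adj (a :: u)) (last a u, a).
Proof. by rewrite /= -!cats1 pairmap_cat. Qed.

Lemma cadj_next w : uniq w -> cadj w = [seq (a, next w a) | a <- w].
Proof.
case: w => // x w Uw; apply: (@eq_from_nth _ (x, x)).
  by rewrite size_map size_pairmap size_rcons.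
move=> i; rewrite size_pairmap size_rcons => lti.
rewrite (nth_map x) // (nth_pairmap x) ?size_rcons // next_nth mem_nth // index_uniq //.
rewrite -rcons_cons !nth_rcons lti; congr pair.
by case: ltnP => // le; rewrite nth_default //; case: eqP.
Qed.

Lemma mem_cadj_rot i w : uniq w -> cadj (rot i w) =i cadj w.
Proof.
move=> Uw p; rewrite !cadj_next ?rot_uniq //.
rewrite (eq_map (g := fun a => (a, next w a))); last by move=> a; rewrite next_rot.
by rewrite map_rot mem_rot.
Qed.
End Adjacency.

Section Words.
Variables (n : nat) (T : {set 'I_n * {set 'I_n}}).
Implicit Types (w u v : seq 'I_n) (p : 'I_n * {set 'I_n}).

Definition tedge (x y : 'I_n) : bool :=
  [exists p in T, ((x == p.1) && (y \in p.2)) || ((y == p.1) && (x \in p.2))].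

(** Outside the edges of [T] a loop [x = y] counts as a descent, in agreement with [cdes] on fixed
    points. *)
Definition st (x y : 'I_n) : int :=
  if tedge x y then 0 else if (x < y)%N then 1 else -1.

Definition touches p (w : {pred 'I_n}) := (p.1 \in w) || [exists a in p.2, a \in w].

Definition peak_of (E : seq ('I_n * 'I_n)) p :=
  [exists a, exists c, [&& (a, p.1) \in E, (p.1, c) \in E,
     (a < p.1)%N, (c < p.1)%N & p.2 == [set a; c]]].

(** Each prescribed peak and its neighbours either avoid the word or occur in it as that peak. In
    this form the condition on a word splits into conditions on the two parts of a cut. *)
Definition valid w := [forall p in T, touches p (mem w) ==> peak_of (adj w) p].
Definition cvalid w := [forall p in T, touches p (mem w) ==> peak_of (cadj w) p].

Lemma tedgeC x y : tedge x y = tedge y x.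
Proof. by apply: eq_existsb => p; rewrite orbC. Qed.

Lemma stC x y : x != y -> st y x = - st x y.
Proof.
rewrite /st tedgeC; case: ifP => // _; rewrite -(inj_eq val_inj) /=.
by case: ltngtP => //; rewrite ?opprK.
Qed.

Lemma st_unit x y : unit_step (st x y).
Proof. by rewrite /st /unit_step; case: ifP => // _; case: ifP. Qed.

Lemma st_eq0 x y : (st x y == 0) = tedge x y.
Proof. by rewrite /st; case: ifP => // _; case: ifP. Qed.

Lemma sub_peak_of (E E' : seq ('I_n * 'I_n)) p :
  {subset E <= E'} -> peak_of E p -> peak_of E' p.
Proof.
move=> sE /existsP[a /existsP[c /and5P[/sE Ea /sE Ec l1 l2 D]]].
by apply/existsP; exists a; apply/existsP; exists c; apply/and5P.
Qed.

Lemma eq_peak_of (E E' : seq ('I_n * 'I_n)) p : E =i E' -> peak_of E p = peak_of E' p.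
Proof. by move=> eE; apply/idP/idP; apply: sub_peak_of => q; rewrite eE. Qed.

Lemma touchesP p (w : {pred 'I_n}) :
  reflect (exists2 a, a \in w & (a == p.1) || (a \in p.2)) (touches p w).
Proof.
apply: (iffP orP) => [[pw|/existsP[a /andP[ap aw]]]|[a aw /orP[/eqP<-|ap]]].
- by exists p.1; rewrite ?eqxx.
- by exists a; rewrite // ap orbT.
- by left.
- by right; apply/existsP; exists a; rewrite ap.
Qed.

Lemma eq_touches p (w1 w2 : {pred 'I_n}) : w1 =i w2 -> touches p w1 = touches p w2.
Proof. by move=> e; rewrite /touches e; congr (_ || _); apply: eq_existsb => a; rewrite e. Qed.

(** One end of an edge of [T] is a prescribed peak, and a peak is never the first or last letter of
    a word. *)
Lemma valid_tedge_ends x w : uniq (x :: w) -> valid (x :: w) -> ~~ tedge (last x w) x.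
Proof.
move=> Uw /forall_inP vw; apply/negP => /existsP[p /andP[pT]].
have peakp : (x == p.1) || (last x w == p.1) -> False.
  move=> xp; have /implyP := vw p pT.
  have -> : touches p (mem (x :: w)).
    apply/touchesP; case/orP: xp => xp; first by exists x; rewrite ?mem_head ?xp.
    by exists (last x w); rewrite ?mem_last ?xp.
  case/(_ isT)/existsP=> a /existsP[c /and5P[Ea Ec _ _ _]].
  case/orP: xp => /eqP xp; first by have := mem_adj_neq_head Uw Ea; rewrite xp eqxx.
  by have := mem_adj_neq_last Uw Ec; rewrite xp eqxx.
by case/orP=> /andP[xp _]; apply: peakp; rewrite xp ?orbT.
Qed.

(** Opening a cycle loses only the adjacency of the last letter with the first, which matters to a
    prescribed peak only when it is an edge of [T]. *)
Lemma cvalidE x w : uniq (x :: w) ->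
  valid (x :: w) = cvalid (x :: w) && (st (last x w) x != 0).
Proof.
move=> Uw; rewrite st_eq0; apply/idP/andP => [vw|[cw nt]].
  split; last exact: valid_tedge_ends.
  apply/forall_inP => p pT; apply/implyP => tp.
  move/forall_inP: vw => /(_ p pT)/implyP/(_ tp).
  by apply: sub_peak_of => e; rewrite cadj_rcons mem_rcons inE orbC => ->.
apply/forall_inP => p pT; apply/implyP => tp.
move/forall_inP: cw => /(_ p pT)/implyP/(_ tp).
case/existsP=> a /existsP[c /and5P[Ea Ec l1 l2 D]].
apply/existsP; exists a; apply/existsP; exists c; rewrite l1 l2 D !andbT.
move: Ea Ec; rewrite cadj_rcons !mem_rcons !inE.
case/orP=> [/eqP[Da Dp]|->]; last case/orP=> [/eqP[Da Dp]|-> //].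
  case/negP: nt; apply/existsP; exists p; rewrite pT -Da -Dp eqxx (eqP D).
  by rewrite !inE eqxx orbT.
case/negP: nt; apply/existsP; exists p; rewrite pT -Da -Dp eqxx (eqP D).
by rewrite !inE eqxx orbT.
Qed.

Lemma cvalid_rot i w : uniq w -> cvalid (rot i w) = cvalid w.
Proof.
move=> Uw; apply: eq_forallb => p; congr (_ ==> (_ ==> _)).
  by apply: eq_touches => a; exact: mem_rot.
by apply: eq_peak_of; apply: mem_cadj_rot.
Qed.

(** Words may be cut exactly at nonzero steps: a prescribed peak spread over both parts would make
    the adjacency at the cut an edge of [T]. *)
Lemma valid_cat a u b v : uniq ((a :: u) ++ b :: v) ->
  valid (a :: u) && valid (b :: v) =
  valid ((a :: u) ++ b :: v) && (st (last a u) b != 0).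
Proof.
set U := a :: u; set W := b :: v => Uw; rewrite st_eq0.
have adjUW : adj (U ++ W) = adj U ++ (last a u, b) :: adj W by exact: adj_cat.
have disj c : c \in U -> c \in W -> False.
  move: Uw; rewrite cat_uniq => /and3P[_ /hasPn h _] cu cv.
  exact: (negP (h c cv)).
have [UU UW] : uniq U /\ uniq W by move: Uw; rewrite cat_uniq => /and3P[].
apply/andP/andP => [[/forall_inP vu /forall_inP vv]|[vw nt]].
  have pkU p : p \in T -> touches p (mem U) -> peak_of (adj U) p.
    by move=> pT; apply/implyP; apply: vu.
  have pkW p : p \in T -> touches p (mem W) -> peak_of (adj W) p.
    by move=> pT; apply/implyP; apply: vv.
  split.
    apply/forall_inP => p pT; apply/implyP => /touchesP[c].
    move=> cUW cp; have : c \in U ++ W := cUW.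
    rewrite mem_cat => /orP[cu|cv].
      have : peak_of (adj U) p by apply: pkU => //; apply/touchesP; exists c.
      by apply: sub_peak_of => e; rewrite adjUW mem_cat => ->.
    have : peak_of (adj W) p by apply: pkW => //; apply/touchesP; exists c.
    by apply: sub_peak_of => e; rewrite adjUW mem_cat inE => ->; rewrite !orbT.
  apply/negP => /existsP[p /andP[pT edge]].
  have tU : touches p (mem U).
    apply/touchesP; exists (last a u); first exact: mem_last.
    by case/orP: edge => /andP[]; [move->|move=> _ ->; rewrite orbT].
  have tW : touches p (mem W).
    apply/touchesP; exists b; first exact: mem_head.
    by case/orP: edge => /andP[]; [move=> _ ->; rewrite orbT|move->].
  have /existsP[x /existsP[y /and5P[Ex _ _ _ _]]] := pkU _ pT tU.
  have /existsP[x' /existsP[y' /and5P[Ex' _ _ _ _]]] := pkW _ pT tW.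
  by apply: (disj p.1); [case: (mem_adj Ex)|case: (mem_adj Ex')].
(* Neither adjacency of a prescribed peak is the one at the cut, so both lie in the part that
   contains the peak. *)
have key p : p \in T -> touches p (mem (U ++ W)) ->
    peak_of (adj U) p \/ peak_of (adj W) p.
  move=> pT tp; move/forall_inP: vw => /(_ p pT)/implyP/(_ tp).
  case/existsP=> x /existsP[y /and5P[Ex Ey l1 l2 D]].
  have := Ex; have := Ey; rewrite adjUW !mem_cat !inE.
  have nx : (x, p.1) == (last a u, b) = false.
    apply/negP => /eqP[Da Dp]; case/negP: nt; apply/existsP; exists p.
    by rewrite pT -Da -Dp eqxx (eqP D) !inE eqxx orbT.
  have ny : (p.1, y) == (last a u, b) = false.
    apply/negP => /eqP[Da Dp]; case/negP: nt; apply/existsP; exists p.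
    by rewrite pT -Da -Dp eqxx (eqP D) !inE eqxx orbT.
  rewrite nx ny !orFb => /orP[Ey'|Ey'] /orP[Ex'|Ex'].
  - by left; apply/existsP; exists x; apply/existsP; exists y; apply/and5P.
  - by case: (disj p.1); [case: (mem_adj Ey')|case: (mem_adj Ex')].
  - by case: (disj p.1); [case: (mem_adj Ex')|case: (mem_adj Ey')].
  - by right; apply/existsP; exists x; apply/existsP; exists y; apply/and5P.
have inpk E p c : peak_of E p -> (c == p.1) || (c \in p.2) ->
    exists d e, [/\ (d, e) \in E & (c == d) || (c == e)].
  case/existsP=> x /existsP[y /and5P[Ex Ey _ _ /eqP->]].
  case/orP=> [cp|]; first by exists x, p.1; rewrite Ex cp orbT.
  rewrite !inE => /orP[cx|cy]; first by exists x, p.1; rewrite Ex cx.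
  by exists p.1, y; rewrite Ey cy orbT.
have inadj w p c : peak_of (adj w) p -> (c == p.1) || (c \in p.2) -> c \in w.
  by move=> pk /(inpk _ _ _ pk)[d [e [/mem_adj[dw ew]]]] /orP[] /eqP->.
split; apply/forall_inP => p pT; apply/implyP => /touchesP[c cw cp].
  have [|//|pk] := key p pT; first by apply/touchesP; exists c => //; change (c \in U ++ W); rewrite mem_cat [c \in U]cw.
  by case: (disj c cw); apply: inadj pk cp.
have [|pk|//] := key p pT.
  by apply/touchesP; exists c => //; change (c \in U ++ W); rewrite mem_cat [c \in W]cw orbT.
by case: (disj c); first apply: inadj pk cp.
Qed.
End Words.

(** * Cutting words and cycles *)

Section WordWeights.
Variables (n : nat) (T : {set 'I_n * {set 'I_n}}) (F : fieldType) (t : F).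
Hypotheses (t_neq0 : t != 0) (t1_neq0 : 1 + t != 0).
Implicit Types (w u v z : seq 'I_n).
Local Notation st := (st T).

Definition steps w : seq int := if w is x :: w' then pairmap st x w' else [::].
Definition csteps w : seq int := if w is x :: w' then pairmap st x (rcons w' x) else [::].

Definition lwt w : F := if valid T w && stays 0 (steps w) then dwt t (steps w) else 0.
(* [theta] takes a factor [-t] per ascent and [-1] per descent, so [- theta] is
   [t ^+ asc] with the sign [(-1) ^+ (number of pieces)]. *)
Definition rwt w : F :=
  if w is [::] then 1
  else if valid T w && low (steps w) then - theta t (steps w) else 0.

Lemma all_unit_pairmap x w : all unit_step (pairmap st x w).
Proof. by elim: w x => //= y w IH x; rewrite st_unit IH. Qed.

Lemma steps_unit w : all unit_step (steps w).
Proof. by case: w => //= x w; exact: all_unit_pairmap. Qed.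
Lemma csteps_unit w : all unit_step (csteps w).
Proof. by case: w => //= x w; exact: all_unit_pairmap. Qed.

Lemma steps_rcons_cat u x v : steps (u ++ x :: v) = steps (rcons u x) ++ steps (x :: v).
Proof. by case: u => //= a u; rewrite -cats1 !pairmap_cat -catA. Qed.

(** The word up to [x] stays on the left of every cut, so it gives a common factor and the height at
    which [cutsum] starts. *)
Lemma sum_cuts_after u x v : uniq (u ++ x :: v) ->
  \sum_(0 <= k < (size v).+1)
     lwt (u ++ take k.+1 (x :: v)) * rwt (drop k.+1 (x :: v)) =
  if valid T (u ++ x :: v) && stays 0 (steps (rcons u x)) then
    dwt t (steps (rcons u x)) * cutsum t (sumz (steps (rcons u x))) (steps (x :: v))
  else 0.
Proof.
move=> Uw; set f := steps (rcons u x).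
rewrite cutsumE mulrBr big_nat_recr //=.
rewrite take_size drop_size [rwt [::]]/= mulr1 [lwt (u ++ x :: v)]/lwt steps_rcons_cat -/f stays_cat add0r [steps (x :: v)]/=.
rewrite dwt_cat addrC size_pairmap.
(* In an invalid word no cut at a nonzero step has two valid parts, since these would join to a
   valid word; at a zero step the parts are never both valid. *)
have [vw|nvw] /= := boolP (valid T _); last first.
  rewrite add0r big1_seq // => k; rewrite mem_index_iota => /andP[_ /andP[_ lk]].
  have [b [v' Dv]] : exists b v', drop k v = b :: v'.
    by rewrite (drop_nth x) //; exists (nth x v k), (drop k.+1 v).
  rewrite Dv; rewrite /lwt /rwt.
  have [a [u' Du]] : exists a u', u ++ x :: take k v = a :: u'.
    by case: (u) => [|a u']; [exists x, (take k v)|exists a, (u' ++ x :: take k v)].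
  have Dw : (a :: u') ++ b :: v' = u ++ x :: v.
    by rewrite -Du -Dv -catA /= cat_take_drop.
  have := @valid_cat n T a u' b v'; rewrite Dw => /(_ Uw).
  rewrite (negbTE nvw) /= Du.
  by case: (valid T (a :: u')) => //= [->|]; rewrite ?mulr0 ?mul0r.
have [sf|nsf] /= := boolP (stays 0 f); last first.
  rewrite add0r big1_seq // => k _; rewrite /lwt steps_rcons_cat stays_cat -/f.
  by rewrite (negbTE nsf) /= andbF mul0r.
congr (_ + _); first by case: ifP; rewrite ?mulr0.
rewrite mulr_sumr -sumrN; apply: eq_big_nat => k /andP[_ lk].
have [b [v' Dv]] : exists b v', drop k v = b :: v'.
  by rewrite (drop_nth x) //; exists (nth x v k), (drop k.+1 v).
have Dv2 : v = take k v ++ b :: v' by rewrite -Dv cat_take_drop.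
have sk : size (take k v) = k by rewrite size_takel // ltnW.
have [a [u' Du]] : exists a u', u ++ x :: take k v = a :: u'.
  by case: (u) => [|a u']; [exists x, (take k v)|exists a, (u' ++ x :: take k v)].
have Dw : (a :: u') ++ b :: v' = u ++ x :: v.
  by rewrite -Du -Dv -catA /= cat_take_drop.
have la : last a u' = last x (take k v).
  by rewrite -(last_cons x a u') -Du last_cat.
have := @valid_cat n T a u' b v'; rewrite Dw => /(_ Uw); rewrite vw /= la => Vc.
have De : pairmap st x v =
    pairmap st x (take k v) ++ st (last x (take k v)) b :: pairmap st b v'.
  by rewrite {1}Dv2 pairmap_cat.
have se : size (pairmap st x (take k v)) = k by rewrite size_pairmap.
rewrite De nth_cat se ltnn subnn /= take_size_cat // drop_cat se ltnNge leqnSn /=.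
rewrite subSnn /= drop0 -Vc Dv /lwt /rwt Du.
have -> : steps (a :: u') = f ++ pairmap st x (take k v).
  by rewrite -Du steps_rcons_cat.
rewrite stays_cat add0r sf dwt_cat /=.
case: (valid T (a :: u')); rewrite /= ?mul0r ?oppr0 ?mulr0 ?oppr0 //.
case: (valid T (b :: v')); rewrite /= ?mul0r ?mulr0 ?oppr0 //.
case: (stays _ _); rewrite /= ?mul0r ?mulr0 ?oppr0 //.
by case: (low _); rewrite /= ?mulr0 ?oppr0 // mulrN mulrA.
Qed.

(** The cut with empty left part contributes [- theta] if the word is valid and [low], which cancels
    the closed form of all the other cuts. *)
Lemma sum_cuts w : uniq w -> w != [::] ->
  \sum_(0 <= j < (size w).+1) lwt (take j w) * rwt (drop j w) = 0.
Proof.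
case: w => // x w Uw _; rewrite big_nat_recl //.
have := @sum_cuts_after [::] x w Uw; rewrite /= => ->.
have -> : lwt [::] = 1.
  rewrite /lwt /= /dwt expr0 andbT.
  suff -> : valid T [::] by [].
  by apply/forall_inP => p _; apply/implyP => /touchesP[a].
rewrite ?drop0 mul1r andbT sumz_nil /dwt expr0 mul1r.
case: (valid T _) => /=; last by rewrite addr0.
apply: (@mulfI _ (1 - - t)); first by rewrite opprK.
rewrite mulr0 mulrDr cutsum_closed ?all_unit_pairmap //.
case lo: (low _); last by rewrite mulr0 addr0.
have := low_sumz lo => s0.
have -> : 0 + 1 - Num.max 0 (0 + sumz (pairmap st x w)) = 1 by lia.
by rewrite expr1z; ring.
Qed.

(** The index [j] opens the cycle at its step [j], and [k] cuts the resulting word so that the first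
    letter of [z] stays on the left. For fixed [j] the cuts add up to one summand of
    [cyclic_cutsum]. *)
Lemma sum_cyclic_cuts z : uniq z ->
  \sum_(0 <= j < size z) \sum_(0 <= k < j.+1)
     lwt (drop j.+1 z ++ take k.+1 z) * rwt (drop k.+1 (take j.+1 z)) =
  if cvalid T z then kappa t (csteps z) else 0.
Proof.
case: z => [|x y] Uz.
  by rewrite big_geq // /kappa /=; case: ifP.
rewrite -cyclic_cutsum ?csteps_unit //.
rewrite [LHS](_ : _ = \sum_(0 <= j < size (csteps (x :: y)))
    if cvalid T (x :: y) then
     (if ((csteps (x :: y))`_j != 0) && stays 0 (drop j.+1 (csteps (x :: y)))
     then dwt t (drop j.+1 (csteps (x :: y))) *
       cutsum t (sumz (drop j.+1 (csteps (x :: y)))) (take j (csteps (x :: y)))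
     else 0) else 0); first by case: ifP => _ //; rewrite big1.
have -> : size (csteps (x :: y)) = size (x :: y) by rewrite size_pairmap size_rcons.
apply: eq_big_nat => j /andP[_ lj].
set u1 := drop j.+1 (x :: y); set y1 := take j y.
have sy : size y1 = j by rewrite size_takel.
transitivity (\sum_(0 <= k < (size y1).+1)
     lwt (u1 ++ take k.+1 (x :: y1)) * rwt (drop k.+1 (x :: y1))).
  rewrite sy; apply: eq_big_nat => k /andP[_ lk].
  by rewrite /= /y1 take_takel.
have Dr : u1 ++ x :: y1 = rot j.+1 (x :: y) by [].
rewrite sum_cuts_after ?Dr ?rot_uniq //.
(* Here [c] is the step at which the cycle is opened, and [f] consists of the steps from there back
   to [x]. *)
have [c [f [Dc Df]]] : exists c f, csteps (x :: y) = steps (x :: y1) ++ c :: f /\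
   (steps (rcons u1 x) = f /\
    valid T (rot j.+1 (x :: y)) = cvalid T (x :: y) && (c != 0)).
  have : uniq (rot j.+1 (x :: y)) by rewrite rot_uniq.
  rewrite -(cvalid_rot T j.+1 Uz) -Dr /u1 /=.
  move: (cat_take_drop j y); rewrite -/y1; case: (drop j y) => [|b y2] Dy Ur.
    rewrite cats0 in Dy; exists (st (last x y1) x), [::].
    by rewrite -Dy -cats1 pairmap_cat /= cvalidE.
  exists (st (last x y1) b), (pairmap st b (rcons y2 x)).
  rewrite -Dy rcons_cat pairmap_cat /=; split=> //; split=> //.
  by rewrite cvalidE // last_cat.
have [Df' ->] := Df; rewrite Df' Dc.
have se : size (steps (x :: y1)) = j by rewrite size_pairmap.
rewrite nth_cat se ltnn subnn /= take_size_cat // drop_cat se ltnNge leqnSn /=.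
rewrite subSnn /= drop0.
by case: (cvalid T _).
Qed.
End WordWeights.

(** * Sums over words on a set of letters *)

Section WordSums.
Variables (A : finType) (R : nmodType).
Implicit Types (S U : {set A}) (w u v z : seq A).

Definition words U : seq (seq A) := permutations (enum U).

Lemma mem_words w U : (w \in words U) = uniq w && ([set a in w] == U).
Proof.
rewrite mem_permutations; apply/idP/andP => [pw|[uw /eqP<-]].
  rewrite (perm_uniq pw) enum_uniq; split=> //; apply/eqP/setP => a.
  by rewrite inE (perm_mem pw) mem_enum.
by apply: uniq_perm => //; [exact: enum_uniq|move=> a; rewrite mem_enum inE].
Qed.

Lemma size_words w U : w \in words U -> size w = #|U|.
Proof. by rewrite mem_permutations => /perm_size->; rewrite cardE. Qed.

Lemma words_uniq w U : w \in words U -> uniq w.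
Proof. by rewrite mem_words => /andP[]. Qed.

Lemma mem_word w U : w \in words U -> w =i U.
Proof. by rewrite mem_permutations => /perm_mem e a; rewrite e mem_enum. Qed.

Lemma card_uniq_set w : uniq w -> #|[set a in w]| = size w.
Proof. by move=> /card_uniqP <-; apply: eq_card => a; rewrite inE. Qed.

(** Two words on complementary sets amount to one word with a cut; [S] is the set of letters before
    the cut. *)
Lemma sum_words_split (f : seq A -> seq A -> R) U :
  \sum_(S : {set A} | S \subset U) \sum_(u <- words S) \sum_(v <- words (U :\: S)) f u v
  = \sum_(w <- words U) \sum_(0 <= j < #|U|.+1) f (take j w) (drop j w).
Proof.
transitivity (\sum_(w <- words U) \sum_(S : {set A} | S \subset U)
    if [set a in take #|S| w] == S then f (take #|S| w) (drop #|S| w) else 0).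
  rewrite exchange_big /=; apply: eq_bigr => S sSU.
  rewrite -big_mkcond /= -[RHS]big_filter.
  transitivity (\sum_(uv <- [seq (u, v) | u <- words S, v <- words (U :\: S)]) f uv.1 uv.2).
    by rewrite big_allpairs_dep; apply: eq_bigr => u _; apply: eq_bigr.
  pose h w := (take #|S| w, drop #|S| w).
  rewrite -[RHS](big_map h xpredT (fun uv => f uv.1 uv.2)) /=; apply: perm_big; apply: uniq_perm.
  - apply: allpairs_uniq_dep; first exact: permutations_uniq.
      by move=> u _; exact: permutations_uniq.
    by move=> [u v] [u' v'] _ _ /= [-> ->].
  - rewrite map_inj_in_uniq ?filter_uniq ?permutations_uniq //.
    by move=> w w' _ _ [e1 e2]; rewrite -(cat_take_drop #|S| w) e1 e2 cat_take_drop.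
  move=> [u v]; apply/allpairsPdep/mapP => /= [[u' [v' [uS vS [-> ->]]]]|[w]].
    have su := size_words uS; exists (u' ++ v').
      rewrite mem_filter -su take_size_cat //.
      have mu := mem_word uS; have mv := mem_word vS.
      rewrite mem_words cat_uniq (words_uniq uS) (words_uniq vS) /= andbT.
      apply/and3P; split.
      - by apply/eqP/setP => a; rewrite inE mu.
      - by apply/hasPn => a; rewrite /= mv mu inE => /andP[].
      - apply/eqP/setP => a; rewrite inE mem_cat mu mv inE.
        by have := subsetP sSU a; case: (a \in S) => //= ->.
    by rewrite /h -su take_size_cat // drop_size_cat.
  rewrite mem_filter mem_words => /andP[/eqP DS /andP[uw /eqP DU]] [-> ->].
  exists (take #|S| w), (drop #|S| w); split=> //; rewrite mem_words.
    by rewrite take_uniq //= DS.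
  rewrite drop_uniq //=; apply/eqP/setP => a; rewrite -DU !inE -{2}DS inE.
  have : uniq (take #|S| w ++ drop #|S| w) by rewrite cat_take_drop.
  rewrite cat_uniq => /and3P[_ /hasPn d _].
  have -> : (a \in w) = (a \in take #|S| w) || (a \in drop #|S| w).
    by rewrite -mem_cat cat_take_drop.
  by case ad: (a \in drop _ _); [rewrite orbT andbT (negbTE (d a ad))|rewrite orbF andNb].
apply: eq_big_seq => w wU; rewrite big_mkord.
have uw := words_uniq wU; have sw := size_words wU.
rewrite [RHS](partition_big (fun j : 'I_#|U|.+1 => [set a in take j w])
   (fun S : {set A} => S \subset U)) /=; last first.
  by move=> j _; apply/subsetP => a; rewrite inE => /mem_take; rewrite (mem_word wU).
apply: eq_bigr => S sSU.
have ct j : (j <= #|U|)%N -> #|[set a in take j w]| = j.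
  by move=> lj; rewrite card_uniq_set ?take_uniq // size_takel // sw.
have lS : (#|S| < #|U|.+1)%N by rewrite ltnS subset_leq_card.
case: eqP => DS; last first.
  rewrite big_pred0 // => j; apply/eqP => Dj; case: DS.
  by rewrite -{1}Dj ct -1?ltnS //; exact: ltn_ord.
rewrite (big_pred1 (Ordinal lS)) // => j /=.
apply/eqP/eqP => [Dj|->] //; apply: val_inj => /=.
by rewrite -Dj ct -1?ltnS //; exact: ltn_ord.
Qed.

Lemma rot_words i w U : (rot i w \in words U) = (w \in words U).
Proof. by rewrite !mem_permutations perm_rot. Qed.

Lemma sum_words_inj (h : seq A -> seq A) (P Q : pred (seq A)) (g : seq A -> R) U :
    {in words U &, injective h} ->
    {in words U, forall w, h w \in words U} ->
    {in words U, forall w, P w = Q (h w)} ->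
  \sum_(w <- words U | Q w) g w = \sum_(w <- words U | P w) g (h w).
Proof.
move=> injh hU PQ.
have ph : perm_eq (words U) (map h (words U)).
  have Uh : uniq (map h (words U)) by rewrite map_inj_in_uniq ?permutations_uniq.
  rewrite perm_sym; apply: uniq_perm; rewrite ?permutations_uniq //.
  have sub : {subset map h (words U) <= words U} by move=> _ /mapP[w wU ->]; exact: hU.
  by have [] := uniq_min_size Uh sub _; rewrite ?size_map.
rewrite (perm_big _ ph) /= big_map big_seq_cond [RHS]big_seq_cond.
by apply: eq_bigl => w; case wU: (w \in _) => //=; rewrite PQ.
Qed.

Definition heads x w := ohead w == Some x.

(** The position of [x] determines the one rotation that brings it to the front. *)
Lemma sum_words_rot x (g : seq A -> R) U : x \in U ->
  \sum_(w <- words U) g w =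
  \sum_(z <- words U | heads x z) \sum_(0 <= j < #|U|) g (rot j.+1 z).
Proof.
move=> xU; rewrite exchange_big /=.
transitivity (\sum_(0 <= j < #|U|) \sum_(w <- words U | heads x (rotr j.+1 w)) g w).
  under [RHS]eq_bigr do rewrite big_mkcond /=.
  rewrite exchange_big /=; apply: eq_big_seq => w wU.
  have sw := size_words wU; have uw := words_uniq wU.
  have xw : x \in w by rewrite (mem_word wU).
  have lk : (index x w < #|U|)%N by rewrite -sw index_mem.
  rewrite big_mkord (bigD1 (rev_ord (Ordinal lk))) //=.
  have hd j : (j < #|U|)%N -> heads x (rotr j.+1 w) = (j == #|U| - (index x w).+1)%N.
    move=> lj; rewrite /heads /rotr /rot sw (drop_nth x) ?sw; last by lia.
    have nthE i : (i < #|U|)%N -> (nth x w i == x) = (i == index x w).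
      move=> li; apply/eqP/eqP => [Dx|->]; last exact: nth_index.
      by rewrite -{1}Dx index_uniq ?sw.
    by rewrite /= (inj_eq (@Some_inj _)) nthE; lia.
  rewrite hd; last by lia.
  rewrite eqxx big1 ?addr0 // => j nj; rewrite hd //.
  case: eqP => // Dj; case/eqP: nj; apply: val_inj => /=; exact: Dj.
apply: eq_bigr => j _; apply: sum_words_inj.
- by move=> w w' _ _; apply: rot_inj.
- by move=> w wU; rewrite rot_words.
- by move=> w wU; rewrite rotK.
Qed.
End WordSums.

(** * The recursion for ballot words *)

Section SetConvolution.
Variables (A : finType) (R : comNzRingType).
Implicit Types (S U V : {set A}) (f g : {set A} -> R).

Lemma sum_setDr (f : {set A} -> {set A} -> R) U :
  \sum_(S : {set A} | S \subset U) f S (U :\: S) =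
  \sum_(S : {set A} | S \subset U) f (U :\: S) S.
Proof.
rewrite (reindex_onto (fun S => U :\: S) (fun S => U :\: S)) /=; last first.
  by move=> S sSU; rewrite setDDr setDv set0U; apply/setIidPr.
apply: eq_big => [S|S /andP[_ /eqP->]] //.
rewrite subsetDl setDDr setDv set0U /=.
by apply/eqP/idP => [<-|/setIidPr]; rewrite ?subsetIl.
Qed.

(* If [g] is the convolution inverse of [f], then dividing the part of [f]
   pointed at [x] by [f] and multiplying back recovers [f]. *)
Lemma pointed_recursion f g U (x : A) : x \in U -> f set0 * g set0 = 1 ->
    (forall V, V != set0 -> \sum_(S : {set A} | S \subset V) f S * g (V :\: S) = 0) ->
  f U = \sum_(S : {set A} | (S \subset U) && (x \in S))
     (\sum_(P : {set A} | (P \subset S) && (x \in P)) f P * g (S :\: P)) * f (U :\: S).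
Proof.
move=> xU fg0 fgV.
under eq_bigr do rewrite mulr_suml.
rewrite (exchange_big_dep (fun P : {set A} => (P \subset U) && (x \in P))) /=; last first.
  by move=> S P /andP[SU _] /andP[PS ->]; rewrite (subset_trans PS SU).
rewrite (bigD1 U) /= ?subxx ?xU // [X in _ = _ + X]big1 ?addr0.
  rewrite (big_pred1 U) => [|S]; first by rewrite setDv -mulrA [g _ * _]mulrC fg0 mulr1.
  rewrite ?xU ?andbT /= eqEsubset; case: (boolP (U \subset S)) => US; rewrite ?andbF ?andbT //.
  by rewrite (subsetP US x xU) ?andbT.
(* For [P] other than [U], writing [S] as [P :|: Q] turns the inner sum into a convolution over the
   nonempty set [U :\: P], which vanishes. *)
move=> P /andP[/andP[PU xP] neP].
have -> : \sum_(S : {set A} | (S \subset U) && (x \in S) && ((P \subset S) && (x \in P)))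
     f P * g (S :\: P) * f (U :\: S) =
   \sum_(Q : {set A} | Q \subset U :\: P) f P * g Q * f ((U :\: P) :\: Q).
  rewrite (reindex_onto (fun Q => P :|: Q) (fun S => S :\: P)) /=; last first.
    move=> S /andP[_ /andP[PS _]]; apply/setP => a; rewrite !inE.
    by case: (boolP (a \in P)) => //= /(subsetP PS)->.
  apply: eq_big => [Q|Q /andP[_ /eqP->]]; last by rewrite setDDl.
  rewrite xP subUset PU subsetUl inE xP /= !andbT subsetD setDUl setDv set0U.
  by rewrite (sameP eqP setDidPl) disjoint_sym.
transitivity (f P * \sum_(S : {set A} | S \subset U :\: P) f S * g ((U :\: P) :\: S)).
  rewrite (sum_setDr (fun S S' => f S * g S')) mulr_sumr; apply: eq_bigr => Q QUP.
  by rewrite -mulrA; congr (_ * _); rewrite mulrC.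
rewrite fgV ?mulr0 //.
apply: contraNneq neP => UP; rewrite eqEsubset PU.
by rewrite -setD_eq0 UP eqxx.
Qed.
End SetConvolution.

(** * Ballot sums, their convolution inverse and the sums over cycles *)

Section BallotRecursion.
Variables (n : nat) (T : {set 'I_n * {set 'I_n}}) (F : fieldType) (t : F).
Hypotheses (t_neq0 : t != 0) (t1_neq0 : 1 + t != 0) (two_neq0 : 2%:R != 0 :> F).
Implicit Types (U S : {set 'I_n}) (w u v z : seq 'I_n).

Definition ballot_sum U : F := \sum_(w <- words U) lwt T t w.
Definition antiballot_sum U : F := \sum_(w <- words U) rwt T t w.
Definition codd z := odd (ups (csteps T z) + downs (csteps T z)).
Definition cycle_wt z : F :=
  if cvalid T z && codd z then t ^+ minn (ups (csteps T z)) (downs (csteps T z)) else 0.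
(** For [x] in [U], fixing the first letter picks one word for each cyclic arrangement of [U]. *)
Definition cycle_sum x U : F := \sum_(z <- words U | heads x z) cycle_wt z.

Lemma words_set0 : words (set0 : {set 'I_n}) = [:: [::]].
Proof. by rewrite /words enum_set0. Qed.

Lemma ballot_sum0 : ballot_sum set0 = 1.
Proof.
rewrite /ballot_sum words_set0 big_seq1 /lwt /= /dwt expr0 andbT.
suff -> : valid T [::] by [].
by apply/forall_inP => p _; apply/implyP => /touchesP[a].
Qed.

Lemma antiballot_sum0 : antiballot_sum set0 = 1.
Proof. by rewrite /antiballot_sum words_set0 big_seq1. Qed.

Lemma ballot_convolution U : U != set0 ->
  \sum_(S : {set 'I_n} | S \subset U) ballot_sum S * antiballot_sum (U :\: S) = 0.
Proof.
move=> U0; transitivity (\sum_(w <- words U) \sum_(0 <= j < #|U|.+1)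
   lwt T t (take j w) * rwt T t (drop j w)).
  rewrite -(sum_words_split (fun u v => lwt T t u * rwt T t v)); apply: eq_bigr => S _.
  by rewrite /ballot_sum mulr_suml; apply: eq_bigr => u _; rewrite mulr_sumr.
rewrite big1_seq // => w /andP[_ wU]; rewrite -(size_words wU).
apply: sum_cuts => //; first exact: words_uniq wU.
by rewrite -size_eq0 (size_words wU) cards_eq0.
Qed.

(** The left part of each cut contains [x]. Grouping words by the rotation that starts with [x]
    produces the double sum of [sum_cyclic_cuts]. *)
Lemma pointed_convolution x U : x \in U ->
  \sum_(S : {set 'I_n} | (S \subset U) && (x \in S)) ballot_sum S * antiballot_sum (U :\: S)
  = \sum_(z <- words U | heads x z) if cvalid T z then kappa t (csteps T z) else 0.
Proof.
move=> xU; transitivity (\sum_(w <- words U) \sum_(0 <= j < #|U|.+1)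
   if x \in take j w then lwt T t (take j w) * rwt T t (drop j w) else 0).
  rewrite -(sum_words_split (fun u v => if x \in u then lwt T t u * rwt T t v else 0)).
  rewrite big_mkcondr /=; apply: eq_bigr => S _; case: ifP => xS.
    rewrite /ballot_sum mulr_suml; apply: eq_big_seq => u uS.
    by rewrite (mem_word uS) xS mulr_sumr.
  by rewrite big1_seq // => u /andP[_ uS]; rewrite big1 // => v _; rewrite (mem_word uS) xS.
rewrite (sum_words_rot _ xU) big_seq_cond [RHS]big_seq_cond.
apply: eq_bigr => z /andP[zU hz].
have uz := words_uniq zU; have sz := size_words zU.
rewrite -(sum_cyclic_cuts _ t_neq0 t1_neq0) // sz; apply: eq_big_nat => j /andP[_ lj].
case: z hz zU uz sz => // y z /eqP[->] {y} zU uz sz.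
have sd : size (drop j.+1 (x :: z)) = (#|U| - j.+1)%N by rewrite size_drop sz.
have st' : size (take j.+1 (x :: z)) = j.+1 by rewrite size_takel // sz.
(* In the rotated word [x] has position [#|U| - j.+1], so shorter left parts miss it and contribute
   0. *)
rewrite /rot (@big_cat_nat _ _ _ (#|U| - j.+1).+1) //=; last by lia.
rewrite big1_seq ?add0r; last first.
  move=> m; rewrite mem_index_iota => /andP[_ /andP[_ lm]].
  rewrite takel_cat ?sd //; case: ifP => // /mem_take /mem_drop xz.
  by case/andP: uz; rewrite xz.
rewrite (_ : #|U|.+1 = j.+1 + (#|U| - j.+1).+1)%N; last by lia.
rewrite -{1}[(#|U| - j.+1).+1]add0n big_addn addnK.
apply: eq_big_nat => k /andP[_ lk].
have -> : (k + (#|U| - j.+1).+1 = size (drop j.+1 (x :: z)) + k.+1)%N.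
  by rewrite sd; lia.
rewrite take_cat ltnNge leq_addr /= addKn drop_cat ltnNge leq_addr /= addKn.
by rewrite mem_cat inE eqxx orbT /= take_takel.
Qed.
Lemma csteps_next z : uniq z -> csteps T z = [seq st T a (next z a) | a <- z].
Proof.
move=> Uz; transitivity [seq st T p.1 p.2 | p <- cadj z].
  case: z {Uz} => //= a w; move: (rcons w a) => r.
  by elim: r a => //= b r IH a; rewrite IH.
by rewrite cadj_next // -map_comp.
Qed.

(** The first letter is kept in front, so that reversal preserves the words with a given head. *)
Definition reverse_cycle z := if z is x :: y then x :: rev y else [::].

Lemma perm_reverse_cycle z : perm_eq (reverse_cycle z) z.
Proof. by case: z => //= x y; rewrite perm_cons perm_rev. Qed.

Lemma next_reverse_cycle z : uniq z -> next (reverse_cycle z) =1 prev z.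
Proof.
case: z => // x y Uz a.
have -> : reverse_cycle (x :: y) = rotr 1 (rev (x :: y)) by rewrite rev_cons rotr1_rcons.
by rewrite next_rotr ?rev_uniq // next_rev.
Qed.

Lemma cvalid_reverse z : uniq z -> cvalid T (reverse_cycle z) = cvalid T z.
Proof.
move=> Uz; have Ur : uniq (reverse_cycle z) by rewrite (perm_uniq (perm_reverse_cycle z)).
have cadjr a b : ((a, b) \in cadj (reverse_cycle z)) = ((b, a) \in cadj z).
  rewrite !cadj_next //; apply/mapP/mapP => -[c cz [-> ->]].
    exists (prev z c); last by rewrite next_reverse_cycle // next_prev.
    by rewrite mem_prev -(perm_mem (perm_reverse_cycle z)).
  exists (next z c); last by rewrite next_reverse_cycle // prev_next.
  by rewrite (perm_mem (perm_reverse_cycle z)) mem_next.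
apply: eq_forallb => p; congr (_ ==> (_ ==> _)).
  by apply: eq_touches => a; exact: (perm_mem (perm_reverse_cycle z)).
have swap w w' : (forall a b, ((a, b) \in cadj w) = ((b, a) \in cadj w')) ->
    peak_of (cadj w) p -> peak_of (cadj w') p.
  move=> sw /existsP[a /existsP[c /and5P[Ea Ec l1 l2 D]]].
  apply/existsP; exists c; apply/existsP; exists a.
  by rewrite -!sw Ea Ec l1 l2 setUC.
by apply/idP/idP; apply: swap => a b; rewrite cadjr.
Qed.

(** Reversal negates every step between distinct letters; the loop of a one-letter cycle keeps its
    step and is excluded. *)
Lemma count_reverse_cycle c z : uniq z -> (1 < size z)%N ->
  count_mem c (csteps T (reverse_cycle z)) = count_mem (- c) (csteps T z).
Proof.
move=> Uz sz; have pr := perm_reverse_cycle z.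
have Ur : uniq (reverse_cycle z) by rewrite (perm_uniq pr).
rewrite !csteps_next // !count_map.
rewrite (eq_count (a2 := fun a => st T a (prev z a) == c)); last first.
  by move=> a /=; rewrite next_reverse_cycle.
rewrite (seq.permP pr).
have pn : perm_eq z (map (next z) z).
  apply: uniq_perm => //; first by rewrite map_inj_uniq //; exact: can_inj (prev_next Uz).
  move=> a; apply/idP/mapP => [az|[b bz ->]]; last by rewrite mem_next.
  by exists (prev z a); rewrite ?mem_prev // next_prev.
rewrite (seq.permP pn) count_map; apply: eq_in_count => b bz /=.
rewrite prev_next // stC ?eqr_oppLR //.
case: (rot_to bz) => i w Dw; rewrite -(next_rot i Uz) Dw.
have : uniq (rot i z) by rewrite rot_uniq.
have : (1 < size (rot i z))%N by rewrite size_rot.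
by rewrite Dw; case: w {Dw} => //= d w _; rewrite inE eqxx negb_or => /andP[/andP[]].
Qed.

Lemma kappa_odd e : odd (ups e + downs e) -> kappa t e = t ^+ minn (ups e) (downs e).
Proof.
rewrite /kappa; case: ltngtP => // [_|->]; last by rewrite addnn odd_double.
by move=> o; rewrite -signr_odd o expr1 opprK mul1r.
Qed.

(** On cycles with an even number of nonzero steps, reversal negates [kappa]. Their sum therefore
    equals its own negative and vanishes, as 2 is nonzero in [F]. *)
Lemma kappa_sum x U :
  \sum_(z <- words U | heads x z) (if cvalid T z then kappa t (csteps T z) else 0)
  = cycle_sum x U.
Proof.
pose E z := if cvalid T z && ~~ codd z then kappa t (csteps T z) else 0.
rewrite /cycle_sum (eq_bigr (fun z => cycle_wt z + E z)); last first.
  move=> z _; rewrite /cycle_wt /E; case: (cvalid T z); rewrite ?addr0 //=.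
  by case: (boolP (codd z)) => /= [/kappa_odd->|_]; rewrite ?addr0 ?add0r.
rewrite big_split /= -[RHS]addr0; congr (_ + _).
set S := \sum_(z <- _ | _) _.
have SN : S = - S.
  rewrite /S -sumrN [LHS](@sum_words_inj _ _ reverse_cycle (heads x) (heads x)).
  - rewrite big_seq_cond [RHS]big_seq_cond; apply: eq_bigr => z /andP[zU _].
    have uz := words_uniq zU; rewrite /E cvalid_reverse // /codd /ups /downs.
    (* A valid one-letter cycle has a single nonzero step, so it is not among the even cycles. *)
    case: (leqP (size z) 1) => [|sz].
      case: z zU uz => [|a [|b w]] //= _ uz _.
        by rewrite /kappa /= if_same oppr0.
      case: (boolP (cvalid T _)) => cv; rewrite ?oppr0 //=.
      suff : odd ((st T a a == 1) + 0 + ((st T a a == -1) + 0)) by move=> ->; rewrite oppr0.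
      suff : st T a a != 0 by have := st_unit T a a; rewrite /unit_step !inE;
        case/or3P => /eqP->.
      rewrite st_eq0; apply/negP => /existsP[p /andP[pT tp]].
      have /existsP[c /existsP[d /and5P[]]] : peak_of (cadj [:: a]) p.
        apply: (implyP (forall_inP cv p pT)); apply/touchesP; exists a; first exact: mem_head.
        by case/orP: tp => /andP[]; [move=> -> _| move=> ->].
      by rewrite /= inE => /eqP[-> ->] _; rewrite ltnn.
    rewrite !count_reverse_cycle // opprK addnC; case: ifP => [/andP[_ ev]|]; rewrite ?oppr0 //.
    rewrite /kappa /ups /downs !count_reverse_cycle // opprK.
    rewrite [(count_mem (-1)%R _ + _)%N]addnC -signr_odd (negbTE ev) expr0 mulN1r.
    by rewrite mulN1r; case: ltngtP => _; rewrite ?opprK ?oppr0.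
  - move=> z z' zU z'U; case: z zU => [|a w] zU; case: z' z'U => [|b v] z'U //= [-> rw].
    by rewrite -(revK w) rw revK.
  - move=> z zU; rewrite mem_permutations (perm_trans (perm_reverse_cycle z)) //.
    by rewrite -mem_permutations.
  - by move=> z _; case: z.
apply/eqP; have : S *+ 2 == 0 by rewrite mulr2n {1}SN addNr.
by rewrite -mulr_natr mulf_eq0 (negbTE two_neq0) orbF.
Qed.

Lemma ballot_sum_rec x U : x \in U ->
  ballot_sum U =
  \sum_(S : {set 'I_n} | (S \subset U) && (x \in S)) cycle_sum x S * ballot_sum (U :\: S).
Proof.
move=> xU; rewrite (@pointed_recursion _ _ ballot_sum antiballot_sum U x) //.
- by apply: eq_bigr => S /andP[_ xS]; rewrite pointed_convolution // kappa_sum.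
- by rewrite ballot_sum0 antiballot_sum0 mulr1.
- exact: ballot_convolution.
Qed.
End BallotRecursion.

(** * The recursion for permutations *)

Section Traject.
Variable A : finType.
Implicit Types (s : {perm A}) (x a : A) (S U : {set A}) (z : seq A).

Lemma fcycle_traject_porbit s x : fcycle s (traject s x #|porbit s x|).
Proof.
have := iter_porbit s x; case: #|_| (card_porbit_neq0 s x) => // N _ sN /=.
by rewrite -{3}sN iterSr -trajectSr fpath_traject.
Qed.

Lemma traject_words s x : traject s x #|porbit s x| \in words (porbit s x).
Proof.
rewrite mem_words uniq_traject_porbit /=; apply/eqP/setP => a.
by rewrite inE -porbit_traject.
Qed.

Lemma next_fcycle s z : fcycle s z -> {in z, forall a, s a = next z a}.
Proof. by move=> cz a az; apply/eqP; exact: next_cycle cz az. Qed.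

(** Following [z] locally already forces the orbit of [x] and its word, so the cycle through [x] is
    recorded by a unique [z]. *)
Lemma porbit_next s x S z : z \in words S -> heads x z ->
  {in S, forall a, s a = next z a} -> porbit s x = S /\ z = traject s x #|S|.
Proof.
move=> zS hz sz; have uz := words_uniq zS; have mz := mem_word zS.
have cz : fcycle s z.
  have ee : {in S &, frel s =2 frel (next z)} by move=> a b aS _ /=; rewrite sz.
  by rewrite (eq_in_cycle ee) ?cycle_next //; apply/allP => a; rewrite mz.
have Dz : z = traject s x #|S|.
  rewrite -(size_words zS); case: z hz {zS uz mz sz} cz => // y w /eqP[->] /=.
  case/fpathP => m Dm; congr cons.
  have := congr1 size Dm; rewrite size_rcons size_traject => Sm.
  by move: Dm; rewrite -Sm trajectSr => /rcons_inj[].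
split=> //.
have xS : x \in S by rewrite -mz; case: z hz {zS uz mz sz cz Dz} => // y w /eqP[->]; exact: mem_head.
have Ss i : (s ^+ i)%g x \in S.
  by elim: i => [|i IH]; rewrite ?expg0 ?perm1 // expgSr permM sz // -mz mem_next mz.
apply/setP => a; apply/idP/idP => [/porbitP[i ->] //|aS].
have : a \in z by rewrite mz.
rewrite Dz => /trajectP[i _ ->]; rewrite -permX; exact: mem_porbit.
Qed.
End Traject.

(** * Weighted sums over permutations, by the cycle through a point *)

Section CycleSums.
Variables (n : nat) (T : {set 'I_n * {set 'I_n}}) (F : fieldType) (t : F).
Implicit Types (U S C : {set 'I_n}) (s c : {perm 'I_n}) (z : seq 'I_n).
Local Notation st := (st T).

Definition cpeak s (p : 'I_n * {set 'I_n}) :=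
  [&& ((s^-1)%g p.1 < p.1)%N, (s p.1 < p.1)%N & p.2 == [set (s^-1)%g p.1; s p.1]].
Definition cycle_valid s C :=
  [forall p in T, touches p (mem C) ==> (p.1 \in C) && cpeak s p].
Definition cups s C := #|[set a in C | st a (s a) == 1]|.
Definition cdowns s C := #|[set a in C | st a (s a) == -1]|.
Definition cyc_wt s C : F :=
  if cycle_valid s C && odd (cups s C + cdowns s C)
  then t ^+ minn (cups s C) (cdowns s C) else 0.
(** Only orbits of points of [U] are weighted; the fixed points outside [U] do not contribute. *)
Definition perm_sum U : F :=
  \sum_(s : {perm 'I_n} | perm_on U s) \prod_(C in porbit s @: U) cyc_wt s C.

Lemma cyc_wt_word s S z : z \in words S -> {in S, forall a, s a = next z a} ->
  cyc_wt s S = cycle_wt T t z.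
Proof.
move=> zS sz; have uz := words_uniq zS; have mz := mem_word zS.
have card (b : int) : #|[set a in S | st a (s a) == b]| = count_mem b (csteps T z).
  rewrite csteps_next // count_map -size_filter -(card_uniqP (filter_uniq _ uz)).
  apply: eq_card => a; rewrite inE mem_filter /= mz andbC.
  by case aS: (a \in S); rewrite ?andbF // !andbT sz.
rewrite /cyc_wt /cycle_wt /codd /cups /cdowns !card; congr (if _ && _ then _ else _).
apply: eq_forallb => p; congr (_ ==> _); rewrite (@eq_touches _ _ _ (mem z)); last first.
  by move=> a; rewrite -[RHS]/(a \in z) mz.
congr (_ ==> _); apply/andP/existsP => [[pS /and3P[l1 l2 D]]|[a /existsP[b]]].
  have pz : p.1 \in z by rewrite mz.
  have Dp : (s^-1)%g p.1 = prev z p.1.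
    by apply: (@perm_inj _ s); rewrite permKV sz ?next_prev // -mz mem_prev.
  exists ((s^-1)%g p.1); apply/existsP; exists (s p.1); rewrite l1 l2 D !cadj_next //.
  rewrite !andbT; apply/andP; split; apply/mapP.
    by exists (prev z p.1); rewrite ?mem_prev // next_prev // Dp.
  by exists p.1; rewrite // sz.
rewrite cadj_next // => /and5P[/mapP[d dz [-> Dp]] /mapP[e ez [De ->]] l1 l2 D].
have pz : p.1 \in z by rewrite De.
have pS : p.1 \in S by rewrite -mz.
have Ds : (s^-1)%g p.1 = d.
  by apply: (@perm_inj _ s); rewrite permKV sz // -mz.
have Dn : next z p.1 = next z e by rewrite De.
by split=> //; rewrite /cpeak Ds sz // Dn l1 l2 D.
Qed.

Lemma eq_cyc_wt s c C : {in C, s =1 c} -> {in C, forall a, (c^-1)%g a \in C} ->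
  cyc_wt s C = cyc_wt c C.
Proof.
move=> sc Cc; rewrite /cyc_wt /cups /cdowns.
have card (b : int) : [set a in C | st a (s a) == b] = [set a in C | st a (c a) == b].
  by apply/setP => a; rewrite !inE; case aC: (a \in C) => //=; rewrite sc.
rewrite !card; congr (if _ && _ then _ else _).
apply: eq_forallb => p; congr (_ ==> (_ ==> _)).
case pC: (p.1 \in C) => //=; rewrite /cpeak.
have -> : (s^-1)%g p.1 = (c^-1)%g p.1.
  by apply: (@perm_inj _ s); rewrite permKV sc ?permKV // Cc.
by rewrite sc.
Qed.

Lemma perm_sum0 : perm_sum set0 = 1.
Proof.
rewrite /perm_sum (big_pred1 1%g) => [|s]; first by rewrite imset0 big_set0.
apply/idP/eqP => [ps|->]; last exact: perm_on1.
by apply: perm_on_id ps _; rewrite cards0.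
Qed.

(** A permutation supported on [U] is the cycle through [x], on a set [S], together with a
    permutation supported on [U :\: S]. *)
Lemma perm_sum_rec x U : x \in U ->
  perm_sum U =
  \sum_(S : {set 'I_n} | (S \subset U) && (x \in S)) cycle_sum T t x S * perm_sum (U :\: S).
Proof.
move=> xU.
have porbitU s a : perm_on U s -> a \in U -> porbit s a \subset U.
  move=> ps aU; apply/subsetP => b /porbitP[i ->].
  by elim: i => [|i IH]; rewrite ?expg0 ?perm1 // expgSr permM perm_closed.
rewrite /perm_sum (partition_big (fun s => porbit s x)
   (fun S : {set 'I_n} => (S \subset U) && (x \in S))) /=; last first.
  by move=> s ps; rewrite porbitU // porbit_id.
apply: eq_bigr => S /andP[SU xS].
rewrite /cycle_sum mulr_suml.
(* Exactly one word [z] matches a permutation with orbit [S]: the trajectory of [x]. *)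
transitivity (\sum_(z <- words S | heads x z)
   \sum_(s : {perm 'I_n} | perm_on U s && [forall a in S, s a == next z a])
     \prod_(C in porbit s @: U) cyc_wt s C).
  under [RHS]eq_bigr do rewrite big_mkcond /=.
  rewrite exchange_big /= big_mkcond /=; apply: eq_bigr => s _.
  case: ifP => [/andP[ps /eqP DS]|ns]; last first.
    rewrite big_seq_cond big1 // => z /andP[zS hz]; case: ifP => // /andP[ps /forall_inP sz].
    have [|DS _] := @porbit_next _ s x S z zS hz; first by move=> a /sz/eqP.
    by rewrite ps DS eqxx in ns.
  rewrite [RHS]big_mkcond (bigD1_seq (traject s x #|S|)) ?permutations_uniq //=; last first.
    by rewrite -DS traject_words.
  have hz : heads x (traject s x #|S|).
    by rewrite -DS /heads; case: #|_| (card_porbit_neq0 s x) => //= m; rewrite eqxx.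
  rewrite hz /= ps.
  have -> /= : [forall a in S, s a == next (traject s x #|S|) a].
    apply/forall_inP => a aS; apply/eqP; apply: next_fcycle.
      by rewrite -DS; exact: fcycle_traject_porbit.
    by rewrite -DS -porbit_traject DS.
  rewrite [X in _ + X]big1_seq ?addr0 // => z /andP[nz zS]; case: ifP => // hz'.
  case: ifP => // /forall_inP sz.
  have [|_ Dz] := @porbit_next _ s x S z zS hz'; first by move=> a /sz/eqP.
  by rewrite Dz eqxx in nz.
rewrite big_seq_cond [RHS]big_seq_cond; apply: eq_bigr => z /andP[zS hz].
have uz := words_uniq zS; have mz := mem_word zS.
(* [c] is the cycle spelled by [z]. The permutations of [U] that follow [z] on [S] are the products
   [c * s] with [s] supported on [U :\: S]. *)
pose c : {perm 'I_n} := perm (can_inj (prev_next uz)).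
have cE a : c a = next z a by rewrite permE.
have c_out a : a \notin S -> c a = a.
  by rewrite cE next_nth mz => /negbTE->.
have cS a : (c a \in S) = (a \in S) by rewrite cE -!mz mem_next.
rewrite (reindex_inj (mulgI c)) /= mulr_sumr; apply: eq_big => [s|s].
  apply/andP/idP => [[pc /forall_inP sS]|ps].
    have sid a : a \in S -> s a = a.
      move=> aS; have := sS ((c^-1)%g a); rewrite -cS permKV => /(_ aS).
      by rewrite permM permKV -cE permKV => /eqP.
    apply/subsetP => a; rewrite !inE => nsa.
    case aS: (a \in S); first by rewrite sid ?eqxx in nsa.
    apply: (subsetP pc); rewrite inE permM c_out ?aS //.
  have sid a : a \in S -> s a = a by move=> aS; apply: (out_perm ps); rewrite inE aS.
  split; last by apply/forall_inP => a aS; rewrite permM -cE sid ?cS.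
  apply/subsetP => a; rewrite inE permM => nsa.
  case aS: (a \in S); first by rewrite (subsetP SU).
  rewrite c_out ?aS // in nsa.
  by have := subsetP ps a nsa; rewrite inE => /andP[].
case/andP=> pc /forall_inP sS.
have csS : {in S, forall a, (c * s)%g a = next z a} by move=> a /sS/eqP.
have [DS _] := porbit_next zS hz csS.
have sid a : a \in S -> s a = a.
  move=> aS; have := sS ((c^-1)%g a); rewrite -cS permKV => /(_ aS).
  by rewrite permM permKV -cE permKV => /eqP.
have snS a : a \notin S -> s a \notin S.
  by apply: contraNN => saS; have /perm_inj e := sid _ saS; rewrite e in saS.
have csE i a : a \notin S -> ((c * s) ^+ i)%g a = (s ^+ i)%g a /\ (s ^+ i)%g a \notin S.
  move=> aS; elim: i => [|i [IH1 IH2]]; first by rewrite !expg0 perm1.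
  by rewrite !expgSr !permM IH1 c_out // snS.
have porE a : a \notin S -> porbit (c * s)%g a = porbit s a.
  move=> aS; apply/setP => b; apply/porbitP/porbitP => -[i ->]; exists i;
  by case: (csE i a aS).
have -> : porbit (c * s)%g @: U = S |: (porbit s @: (U :\: S)).
  rewrite -[U in LHS](setID U S) imsetU (setIidPr SU); congr (_ :|: _).
    apply/setP => C; rewrite inE; apply/imsetP/eqP => [[a aS ->]|->].
      by apply/eqP; rewrite -DS eq_porbit_mem DS.
    by exists x.
  by apply: eq_in_imset => a; rewrite inE => /andP[aS _]; exact: porE.
rewrite big_setU1 /=; last first.
  apply/imsetP => -[a]; rewrite inE => /andP[aS _] DS'.
  by case/negP: aS; rewrite DS' porbit_id.
rewrite (cyc_wt_word zS csS); congr (_ * _); apply: eq_bigr => C /imsetP[a].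
rewrite inE => /andP[aS _] ->; apply: eq_cyc_wt => b /porbitP[i ->].
  by rewrite permM c_out //; case: (csE i a aS).
have := porbitV s ((s ^+ i)%g a); rewrite porbit_perm => <-.
by apply/porbitP; exists 1%N; rewrite expg1.
Qed.
End CycleSums.

(** Both sides obey the same recursion with the same cycle sums and take the value 1 on the empty
    set. *)
Lemma perm_sum_ballot_sum n (T : {set 'I_n * {set 'I_n}}) (F : fieldType) (t : F) U :
  t != 0 -> 1 + t != 0 -> 2%:R != 0 :> F -> perm_sum T t U = ballot_sum T t U.
Proof.
move=> t0 t1 two0; have [m leUm] := ubnP #|U|; elim: m U leUm => // m IH U leUm.
have [->|[x xU]] := set_0Vmem U; first by rewrite perm_sum0 ballot_sum0.
rewrite (perm_sum_rec _ _ xU) (ballot_sum_rec _ t0 t1 two0 xU).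
apply: eq_bigr => S /andP[SU xS]; rewrite IH //.
apply: leq_trans (proper_card _) leUm; rewrite properEneq subsetDl andbT.
by apply: contraTneq xU => <-; rewrite inE xS.
Qed.

(** * Ballot permutations and odd permutations *)

Lemma staysP h e : reflect (forall k, (k <= size e)%N -> 0 <= h + sumz (take k e)) (stays h e).
Proof.
elim: e h => [|a e IH] h /=.
  by apply: (iffP andP) => [[h0 _] k|/(_ 0%N isT)]; rewrite ?sumz_nil ?addr0.
apply: (iffP andP) => [[h0 /IH sk] [|k]|sk].
- by rewrite sumz_nil addr0.
- by move=> /sk; rewrite sumz_cons addrA.
split; first by have := sk 0%N isT; rewrite sumz_nil addr0.
by apply/IH => k lk; have := sk k.+1 lk; rewrite sumz_cons addrA.
Qed.

(* Steps of [s] agree with those of [s0] except that each letter marked by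
   [tau] is an isolated peak of [s0] which [s] flattens. *)
Lemma flatten_steps (A : eqType) (s0 s : A -> A -> int) (tau : pred A) x w :
    ~~ tau x -> ~~ tau (last x w) ->
    (forall a b, (a, b) \in pairmap pair x w ->
       [/\ ~~ tau a -> ~~ tau b -> s0 a b = s a b,
           tau b -> [/\ ~~ tau a, s0 a b = 1 & s a b = 0] &
           tau a -> [/\ ~~ tau b, s0 a b = -1 & s a b = 0]]) ->
  (forall h, stays h (pairmap s0 x w) = stays h (pairmap s x w)) /\
  downs (pairmap s0 x w) = (downs (pairmap s x w) + count tau w)%N.
Proof.
have [m] := ubnP (size w); elim: m x w => // m IH x [|b w] //= lew tx tl sP.
have [s1 s2 _] := sP x b (mem_head _ _).
have tailP a c : (a, c) \in pairmap pair b w ->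
       [/\ ~~ tau a -> ~~ tau c -> s0 a c = s a c,
           tau c -> [/\ ~~ tau a, s0 a c = 1 & s a c = 0] &
           tau a -> [/\ ~~ tau c, s0 a c = -1 & s a c = 0]].
  by move=> ac; apply: sP; rewrite inE ac orbT.
case: (boolP (tau b)) => tb; last first.
  have [IH1 IH2] := IH b w lew tb tl tailP.
  rewrite s1 //; split=> [h|]; first by rewrite IH1.
  by rewrite /downs /= -/(downs _) IH2 add0n addnA.
have [_ -> ->] := s2 tb; case: w lew tl sP tailP => [|c w] /= lew tl sP tailP.
  by rewrite tb in tl.
have [_ _ /(_ tb)[tc -> ->]] := tailP b c (mem_head _ _).
have [|IH1 IH2] := IH c w (ltnW lew) tc tl.
  by move=> a d ad; apply: tailP; rewrite inE ad orbT.
(* An up-step followed by a down-step does not go below its start, so flattening both leaves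
   nonnegativity unchanged. *)
split=> [h|]; first by rewrite !addr0 addrK IH1; case: (0 <= h) / idP => //= h0; rewrite ?addr_ge0.
by rewrite (negbTE tc); move: IH2; rewrite /downs /=; lia.
Qed.

(** * Prescribed peaks in one-line notation *)

Section Linear.
Variables (n : nat) (T : {set 'I_n * {set 'I_n}}).
Implicit Types (p s : {perm 'I_n}) (w : seq 'I_n).

Definition line p : seq 'I_n := [seq p i | i <- enum 'I_n].
Definition tops : {set 'I_n} := [set x.1 | x in T].

Lemma oneline_line p : oneline p = map val (line p).
Proof. by rewrite /line -[RHS]map_comp. Qed.

Lemma size_line p : size (line p) = n.
Proof. by rewrite size_map size_enum_ord. Qed.

Lemma line_uniq p : uniq (line p).
Proof. by rewrite map_inj_uniq ?enum_uniq //; exact: perm_inj. Qed.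

Lemma mem_line p a : a \in line p.
Proof. by apply/mapP; exists ((p^-1)%g a); rewrite ?mem_enum ?permKV. Qed.

Lemma nth_line p x (i : 'I_n) : nth x (line p) i = p i.
Proof. by rewrite (nth_map i) ?size_enum_ord // nth_ord_enum. Qed.

Lemma mem_adj_line p a b :
  reflect (exists i j : 'I_n, [/\ val j = (val i).+1, a = p i & b = p j])
    ((a, b) \in adj (line p)).
Proof.
have nthadj (x : 'I_n) w i : (i.+1 < size w)%N -> nth (x, x) (adj w) i = (nth x w i, nth x w i.+1).
  by case: w => //= y w lti; rewrite (nth_pairmap x).
have szadj w : size (adj w) = (size w).-1 by case: w => //= x w; rewrite size_pairmap.
apply: (iffP idP) => [/(nthP (a, a))[i]|[i [j [ij -> ->]]]].
  rewrite szadj size_line => lti; rewrite nthadj ?size_line; last by lia.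
  have lti1 : (i.+1 < n)%N by lia.
  have lti0 : (i < n)%N by lia.
  rewrite (nth_line p a (Ordinal lti0)) (nth_line p a (Ordinal lti1)) => -[<- <-].
  by exists (Ordinal lti0), (Ordinal lti1).
have lj := ltn_ord j; rewrite ij in lj.
rewrite -(nth_line p (p i) i) -(nth_line p (p i) j) ij -nthadj ?size_line //.
by rewrite mem_nth // szadj size_line -ltnS (ltn_predK lj).
Qed.

Lemma peak_of_line p x : peak_of (adj (line p)) x = (x \in PEAK p).
Proof.
rewrite inE; apply/existsP/existsP => [[a /existsP[c /and5P[]]]|[i /existsP[j /existsP[k]]]].
  case/mem_adj_line=> i [j [ij -> Dx]] /mem_adj_line[j' [k [jk Dx' ->]]].
  have Dj : j' = j by apply: (@perm_inj _ p); rewrite -Dx' Dx.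
  subst j' => l1 l2 /eqP D; exists i; apply/existsP; exists j; apply/existsP; exists k.
  by apply/and5P; split; [exact/eqP|exact/eqP|rewrite -Dx|rewrite -Dx|rewrite -Dx -D; case: (x) => /=].
case/and5P=> /eqP ij /eqP jk l1 l2 /eqP->; exists (p i); apply/existsP; exists (p k).
by apply/and5P; split=> //=; apply/mem_adj_line; [exists i, j|exists j, k].
Qed.

Lemma valid_line p : valid T (line p) = (T \subset PEAK p).
Proof.
apply/forall_inP/subsetP => vT x xT.
  rewrite -peak_of_line; apply: (implyP (vT x xT)).
  by apply/touchesP; exists x.1; rewrite ?eqxx //; exact: mem_line.
by rewrite peak_of_line vT // implybT.
Qed.

Lemma sum_line (V : nmodType) (g : seq 'I_n -> V) :
  \sum_(w <- words [set: 'I_n]) g w = \sum_(p : {perm 'I_n}) g (line p).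
Proof.
rewrite -(big_map line xpredT g); apply: perm_big; rewrite perm_sym.
have li : injective line.
  move=> p q pq; apply/permP => i.
  by rewrite -(nth_line p i i) -(nth_line q i i) pq.
have U : uniq [seq line p | p <- index_enum {perm 'I_n}].
  by rewrite map_inj_uniq // -[index_enum _]/(index_enum _) index_enum_uniq.
apply: uniq_perm => //; first exact: permutations_uniq.
have sub : {subset [seq line p | p <- index_enum {perm 'I_n}] <= words [set: 'I_n]}.
  move=> _ /mapP[p _ ->]; rewrite mem_words line_uniq /=.
  by apply/eqP/setP => a; rewrite !inE mem_line.
have [] // := uniq_min_size U sub _.
rewrite size_map size_permutations ?enum_uniq // -cardE cardsT card_ord.
by rewrite -card_Sn cardT enumT -[index_enum _]/(Finite.enum _) unlock.
Qed.

Lemma st_set0 (x y : 'I_n) : st set0 x y = if (x < y)%N then 1 else -1.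
Proof.
rewrite /st; suff -> : tedge set0 x y = false by [].
by apply/negbTE/existsPn => q; rewrite inE.
Qed.

Lemma seq_stats w : uniq w ->
  des_seq (map val w) = downs (steps set0 w) /\ asc_seq (map val w) = ups (steps set0 w).
Proof.
rewrite /des_seq /asc_seq; case: w => [|x w] /=; first by rewrite !big_ord0.
rewrite size_map; elim: w x => [|y w IH] x /=; first by rewrite !big_ord0.
case/andP=> xy /IH[IHd IHa]; rewrite !big_ord_recl /= IHd IHa st_set0 /downs /ups /=.
have : val x != val y by apply: contraNneq xy => /val_inj->; exact: mem_head.
by case: ltngtP.
Qed.

Lemma take_pairmap (A B : Type) (f : A -> A -> B) x (v : seq A) k :
  take k (pairmap f x v) = pairmap f x (take k v).
Proof. by elim: v x k => [|y v IH] x [|k] //=; rewrite IH. Qed.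

Lemma ballot_stays p : ballot p = stays 0 (steps set0 (line p)).
Proof.
rewrite /ballot oneline_line.
have := line_uniq p; have := size_line p; case: (line p) => [|x w] sw uw.
  by rewrite [RHS]/=; apply/forallP => i; rewrite /des_seq big_ord0.
(* A prefix of [k.+1] letters has [k] steps, whose sum is its ascents minus its descents. *)
have stat k : (k <= size w)%N ->
    (des_seq (take k.+1 (map val (x :: w))) <= asc_seq (take k.+1 (map val (x :: w))))%N
    = (0 <= 0 + sumz (take k (steps set0 (x :: w)))).
  move=> lk; rewrite -map_take; have [|-> ->] := @seq_stats (take k.+1 (x :: w)).
    exact: take_uniq.
  rewrite /= take_pairmap add0r sumz_count ?subr_ge0 ?lez_nat //.
  exact: (steps_unit set0 (x :: take k w)).
apply/forallP/staysP => [b k|b [[|k] lk]].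
- rewrite size_pairmap => lk; rewrite -stat //.
  by have lk1 : (k.+1 < n.+1)%N by [rewrite -sw ltnS]; exact: (b (Ordinal lk1)).
- by rewrite take0 /des_seq big_ord0.
- have lk' : (k <= size w)%N by rewrite -ltnS -[(size w).+1]/(size (x :: w)) sw.
  by rewrite stat // b // size_pairmap.
Qed.

(** The steps for [T] flatten the ascent into and the descent out of each prescribed peak, so one
    descent per top disappears. Tops are isolated, as the neighbours of a peak are smaller than
    it. *)
Lemma line_stats p : T \subset PEAK p ->
  ballot p = stays 0 (steps T (line p)) /\ des p = (downs (steps T (line p)) + #|tops|)%N.
Proof.
move=> TP; rewrite ballot_stays.
rewrite /des oneline_line; have [-> _] := seq_stats (line_uniq p).
have -> : #|tops| = count (mem tops) (line p).
  rewrite -size_filter -(card_uniqP (filter_uniq _ (line_uniq p))).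
  by apply: eq_card => a; rewrite mem_filter mem_line andbT.
have pk q : q \in T -> exists a c, [/\ (a, q.1) \in adj (line p), (q.1, c) \in adj (line p),
    (a < q.1)%N, (c < q.1)%N & q.2 = [set a; c]].
  move/(subsetP TP); rewrite -peak_of_line => /existsP[a /existsP[c /and5P[? ? ? ? /eqP?]]].
  by exists a, c.
have pred_inj a a' b : (a, b) \in adj (line p) -> (a', b) \in adj (line p) -> a = a'.
  case/mem_adj_line=> i [j [ij -> ->]] /mem_adj_line[i' [j' [ij' -> /perm_inj Dj]]].
  by congr (p _); apply: val_inj; move: ij'; rewrite -Dj ij => -[].
have succ_inj a b b' : (a, b) \in adj (line p) -> (a, b') \in adj (line p) -> b = b'.
  case/mem_adj_line=> i [j [ij -> ->]] /mem_adj_line[i' [j' [ij' /perm_inj Di ->]]].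
  by congr (p _); apply: val_inj; rewrite ij ij' Di.
have topP a : a \in tops -> exists2 q, q \in T & a = q.1 by case/imsetP=> q qT ->; exists q.
have top_in a b : (a, b) \in adj (line p) -> b \in tops -> (a < b)%N /\ tedge T a b.
  move=> ab /topP[q qT Db]; have [a' [c [Ea _ l1 _ D]]] := pk q qT.
  rewrite -Db in Ea; have Da := pred_inj _ _ _ ab Ea; rewrite Da Db; split=> //.
  by apply/existsP; exists q; rewrite qT eqxx D !inE eqxx /= orbT.
have top_out a b : (a, b) \in adj (line p) -> a \in tops -> (b < a)%N /\ tedge T a b.
  move=> ab /topP[q qT Da]; have [a' [c [_ Ec _ l2 D]]] := pk q qT.
  rewrite -Da in Ec; have Db := succ_inj _ _ _ ab Ec; rewrite Da Db; split=> //.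
  by apply/existsP; exists q; rewrite qT eqxx D !inE eqxx /= orbT.
have := line_uniq p; case: (line p) pk top_in top_out => [|x w] //= pk top_in top_out Uw.
have tx : x \notin tops.
  apply/negP => /topP[q /pk[a [c [Ea _ _ _ _]]] Dx].
  by have := @mem_adj_neq_head _ a q.1 x w Uw Ea; rewrite Dx eqxx.
have tl : last x w \notin tops.
  apply/negP => /topP[q /pk[a [c [_ Ec _ _ _]]] Dx].
  by have := @mem_adj_neq_last _ q.1 c x w Uw Ec; rewrite Dx eqxx.
have [|-> ->] := @flatten_steps _ (st set0) (st T) (mem tops) x w tx tl; last first.
  by rewrite (negbTE tx).
move=> a b ab; split=> [ta tb|tb|ta]; rewrite st_set0.
- rewrite /st; suff -> : tedge T a b = false by [].
  apply/negbTE/negP => /existsP[q /andP[qT /orP[/andP[/eqP Da _]|/andP[/eqP Db _]]]].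
    by case/negP: ta; apply/imsetP; exists q.
  by case/negP: tb; apply/imsetP; exists q.
- have [lab eab] := top_in _ _ ab tb; rewrite lab /st eab; split=> //.
  by apply/negP => /(top_out _ _ ab)[]; rewrite ltnNge ltnW.
- have [lba eab] := top_out _ _ ab ta; rewrite ltnNge ltnW //= /st eab; split=> //.
  by apply/negP => /(top_in _ _ ab)[]; rewrite ltnNge ltnW.
Qed.

(** The power of [t] restores the descents flattened at the tops. *)
Lemma ballot_gf (F : fieldType) (t : F) :
  \sum_(p : {perm 'I_n} | (p \in ballot_set n) && (T \subset PEAK p)) t ^+ des p
  = t ^+ #|tops| * ballot_sum T t [set: 'I_n].
Proof.
rewrite /ballot_sum sum_line mulr_sumr big_mkcond /=; apply: eq_bigr => p _.
rewrite inE /lwt valid_line; case TP: (T \subset PEAK p); last by rewrite andbF mulr0.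
have [-> ->] := line_stats TP; rewrite andbT /=.
by case: ifP; rewrite ?mulr0 // exprD mulrC.
Qed.
End Linear.

(** * Prescribed cyclic peaks and odd cycles *)

Section Cyclic.
Variables (n : nat) (T : {set 'I_n * {set 'I_n}}).
Implicit Types (s : {perm 'I_n}) (C : {set 'I_n}).

Lemma mem_porbits s C a : C \in porbits s -> (porbit s a == C) = (a \in C).
Proof. by case/imsetP=> b _ ->; rewrite eq_porbit_mem. Qed.

Lemma porbits_closed s C a : C \in porbits s -> (s a \in C) = (a \in C).
Proof.
by move=> Cs; rewrite -!(mem_porbits _ Cs); have := porbit_perm s 1 a; rewrite expg1 => ->.
Qed.

Lemma sum_porbits s (f : 'I_n -> nat) :
  (\sum_(C in porbits s) \sum_(a in C) f a = \sum_a f a)%N.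
Proof.
rewrite [RHS](partition_big (porbit s) (mem (porbits s))) /=; last first.
  by move=> a _; exact: imset_f.
by apply: eq_bigr => C Cs; apply: eq_bigl => a; rewrite (mem_porbits _ Cs).
Qed.

Lemma cpeakE s (p : 'I_n * {set 'I_n}) : cpeak s p = (p \in cPEAK s).
Proof.
rewrite inE; apply/idP/existsP => [/and3P[l1 l2 /eqP D]|[b /and3P[l1 l2 /eqP->]]].
  by exists p.1; rewrite l1 l2 -D; case: (p) => /=.
by rewrite /cpeak l1 l2 eqxx.
Qed.

Lemma all_cycle_valid s :
  (T \subset cPEAK s) = [forall C in porbits s, cycle_valid T s C].
Proof.
apply/subsetP/forall_inP => [Ts C Cs|vs p pT].
  apply/forall_inP => p pT; apply/implyP => /touchesP[a aC pa].
  have := Ts p pT; rewrite -cpeakE => cp; rewrite cp andbT.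
  case/orP: pa => [/eqP<- //|]; case/and3P: cp => _ _ /eqP->.
  have {}aC : a \in C := aC.
  rewrite !inE => /orP[] /eqP Da; move: aC; rewrite Da.
    by rewrite -(porbits_closed _ Cs) permKV.
  by rewrite (porbits_closed _ Cs).
have Cs : porbit s p.1 \in porbits s by exact: imset_f.
rewrite -cpeakE.
have /implyP/(_ _)/andP[] // := forall_inP (vs _ Cs) p pT.
by apply/touchesP; exists p.1; rewrite ?eqxx //; exact: porbit_id.
Qed.

(** Each prescribed peak on [C] hides one cyclic ascent, the step into it, and one cyclic descent,
    the step out of it. *)
Lemma cycle_stats s C : T \subset cPEAK s -> C \in porbits s ->
  casc s C = (cups T s C + #|C :&: tops T|)%N /\
  cdes s C = (cdowns T s C + #|C :&: tops T|)%N.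
Proof.
move=> Ts Cs.
have pk p : p \in T -> cpeak s p by move/(subsetP Ts); rewrite -cpeakE.
have topP a : a \in tops T -> exists2 q, q \in T & a = q.1 by case/imsetP=> q qT ->; exists q.
have top_in a : s a \in tops T -> (a < s a)%N /\ tedge T a (s a).
  case/topP=> q qT Dq; have /and3P[l1 _ /eqP D] := pk q qT.
  have Da : a = (s^-1)%g q.1 by rewrite -Dq permK.
  rewrite {1}Da Dq; split=> //.
  by apply/existsP; exists q; rewrite qT eqxx D -Da !inE eqxx /= orbT.
have top_out a : a \in tops T -> (s a < a)%N /\ tedge T a (s a).
  case/topP=> q qT ->; have /and3P[_ l2 /eqP D] := pk q qT; split=> //.
  by apply/existsP; exists q; rewrite qT eqxx D !inE eqxx /= orbT.
have edge a : tedge T a (s a) -> (a \in tops T) || (s a \in tops T).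
  case/existsP=> q /andP[qT /orP[/andP[/eqP-> _]|/andP[/eqP-> _]]]; apply/orP.
    by left; apply/imsetP; exists q.
  by right; apply/imsetP; exists q.
have cardS : #|[set a in C | s a \in tops T]| = #|C :&: tops T|.
  rewrite -(card_imset _ (@perm_inj _ s)); apply: eq_card => b; apply/imsetP/idP.
    by case=> a; rewrite !inE => /andP[aC ta] ->; rewrite (porbits_closed _ Cs) aC.
  rewrite inE => /andP[bC tb]; exists ((s^-1)%g b); rewrite ?permKV // inE.
  by rewrite -(porbits_closed _ Cs) permKV bC.
have Ea : casc s C = (cups T s C + #|C :&: tops T|)%N.
  rewrite /casc /cups -cardS -cardsUI [X in (_ + X)%N](_ : _ = 0%N) ?addn0; last first.
    apply/eqP; rewrite cards_eq0; apply/eqP/setP => a; rewrite !inE.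
    apply/negP => /andP[/andP[_ s1] /andP[_ /top_in[_ e]]].
    by move: s1; rewrite /st e.
  apply: eq_card => a; rewrite !inE; case: (a \in C) => //=.
  case ta: (s a \in tops T); first by rewrite orbT; case: (top_in _ ta).
  rewrite orbF /st; case e: (tedge _ _); last by case: ifP.
  have := edge _ e; rewrite ta orbF => /top_out[l _].
  by rewrite ltnNge ltnW.
split=> //.
have cC : (casc s C + #|[set a in C | ~~ (a < s a)%N]| = #|C|)%N.
  rewrite /casc -cardsUI [X in (_ + X)%N](_ : _ = 0%N) ?addn0; last first.
    apply/eqP; rewrite cards_eq0; apply/eqP/setP => a; rewrite !inE.
    by case: (a < s a)%N; rewrite ?andbF.
  by apply: eq_card => a; rewrite !inE -andb_orr orbN andbT.
rewrite /cdes -cC addKn /cdowns -cardsUI [X in (_ = _ + X)%N](_ : _ = 0%N) ?addn0; last first.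
  apply/eqP; rewrite cards_eq0; apply/eqP/setP => a; rewrite !inE.
  apply/negP => /andP[/andP[_ s1] /andP[_ /top_out[_ e]]].
  by move: s1; rewrite /st e.
apply: eq_card => a; rewrite !inE; case: (a \in C) => //=.
case ta: (a \in tops T).
  by rewrite orbT; case: (top_out _ ta) => l _; rewrite ltnNge ltnW.
rewrite orbF /st; case e: (tedge _ _); last by case: ifP.
by have := edge _ e; rewrite ta => /top_in[-> _].
Qed.

Lemma prod_cond_exp (F : fieldType) (t : F) (I : finType) (P b : pred I) (m : I -> nat) :
  \prod_(i | P i) (if b i then t ^+ m i else 0)
  = if [forall (i | P i), b i] then t ^+ (\sum_(i | P i) m i) else 0.
Proof.
case: ifP => [/forall_inP bP|/negbT].
  by rewrite expr_sum; apply: eq_bigr => i Pi; rewrite bP.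
rewrite negb_forall_in => /exists_inP[i Pi nb].
by rewrite (bigD1 i) //= (negbTE nb) mul0r.
Qed.

(** Two hidden steps per top leave the parity of a cycle unchanged and lower both counts, hence
    their minimum, by the number of tops on the cycle. *)
Lemma odd_gf (F : fieldType) (t : F) :
  \sum_(s : {perm 'I_n} | (s \in odd_set n) && (T \subset cPEAK s)) t ^+ exct s
  = t ^+ #|tops T| * perm_sum T t [set: 'I_n].
Proof.
rewrite /perm_sum mulr_sumr [RHS](eq_bigl xpredT); last first.
  by move=> s; apply/subsetP => a; rewrite inE.
rewrite big_mkcond; apply: eq_bigr => s _.
have -> : porbit s @: [set: 'I_n] = porbits s.
  by apply/setP => C; apply/imsetP/imsetP => -[a _ ->]; exists a.
rewrite [X in _ * X](_ : _ = if [forall C in porbits s, cycle_valid T s C &&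
      odd (cups T s C + cdowns T s C)]
   then t ^+ (\sum_(C in porbits s) minn (cups T s C) (cdowns T s C)) else 0); last first.
  by rewrite -prod_cond_exp.
have -> : [forall C in porbits s, cycle_valid T s C && odd (cups T s C + cdowns T s C)]
   = (T \subset cPEAK s) && [forall C in porbits s, odd (cups T s C + cdowns T s C)].
  rewrite all_cycle_valid; apply/forall_inP/andP => [vo|[/forall_inP v /forall_inP o] C Cs].
    by split; apply/forall_inP => C /vo/andP[].
  by rewrite v ?o.
rewrite inE; case Ts: (T \subset cPEAK s); last by rewrite andbF mulr0.
have -> : odd_cycles s = [forall C in porbits s, odd (cups T s C + cdowns T s C)].
  apply: eq_forallb => C; case Cs: (C \in porbits s) => //=.
  have [Ea Ed] := cycle_stats Ts Cs.
  have <- : (casc s C + cdes s C = #|C|)%N.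
    rewrite /cdes subnKC //; apply: subset_leq_card.
    by apply/subsetP => a; rewrite inE => /andP[].
  by rewrite Ea Ed addnACA addnn oddD odd_double addbF.
rewrite andbT /=; case: ifP => _; last by rewrite mulr0.
rewrite -exprD; congr (t ^+ _); rewrite /exct.
rewrite [LHS](eq_bigr (fun C => minn (cups T s C) (cdowns T s C) + #|C :&: tops T|)%N).
  rewrite big_split /= addnC; congr (_ + _)%N.
  have card_sum (X : {set 'I_n}) : #|X| = (\sum_a (a \in X : nat))%N.
    by rewrite -sum1_card big_mkcond; apply: eq_bigr => a _; case: (a \in X).
  rewrite (card_sum (tops T)) -(sum_porbits s); apply: eq_bigr => C _.
  rewrite card_sum [RHS]big_mkcond; apply: eq_bigr => a _.
  by rewrite inE; case: (a \in C).
by move=> C Cs; have [-> ->] := cycle_stats Ts Cs; rewrite addn_minl.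
Qed.
End Cyclic.

(** * From generating functions to a bijection *)

(** Moebius inversion, by induction from larger to smaller [T]: subtracting the exact sums over all
    proper supersets from the superset sum leaves the exact sum at [T]. *)
Lemma superset_sum_inj (I J K : finType) (V : zmodType) (X : pred I) (Y : pred J)
    (P : I -> {set K}) (Q : J -> {set K}) (a : I -> V) (b : J -> V) :
    (forall T : {set K}, \sum_(x | X x && (T \subset P x)) a x =
                         \sum_(y | Y y && (T \subset Q y)) b y) ->
  forall T : {set K}, \sum_(x | X x && (P x == T)) a x = \sum_(y | Y y && (Q y == T)) b y.
Proof.
move=> eqXY T; have [m] := ubnP #|~: T|; elim: m T => // m IH T leTm.
have split (L : finType) (Z : pred L) (R : L -> {set K}) (c : L -> V) :
    \sum_(x | Z x && (R x == T)) c x = \sum_(x | Z x && (T \subset R x)) c x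
      - \sum_(T' : {set K} | T \proper T') \sum_(x | Z x && (R x == T')) c x.
  rewrite [X in _ = X - _](partition_big R (fun T' : {set K} => T \subset T')) /=; last by move=> x /andP[].
  rewrite (bigD1 T) ?subxx //= [X in _ = X + _ - _](eq_bigl (fun x => Z x && (R x == T))); last first.
    by move=> x; rewrite -andbA; case: eqP => [->|]; rewrite ?andbF // subxx.
  rewrite [X in _ = _ + X - _](eq_big (fun T' : {set K} => T \proper T')
     (fun T' => \sum_(x | Z x && (R x == T')) c x)); first by rewrite addrK.
    by move=> T'; rewrite properEneq andbC eq_sym.
  move=> T' /andP[TT' _]; apply: eq_bigl => x; rewrite -andbA.
  by case: eqP => [->|]; rewrite ?andbF // TT'.
rewrite !split eqXY; congr (_ - _); apply: eq_bigr => T' TT'; apply: IH.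
by rewrite -ltnS; apply: leq_trans leTm; rewrite ltnS proper_card // properC.
Qed.

Lemma fiber_bijection (I : finType) (L : eqType) (X Y : {set I}) (f g : I -> L) :
    (forall l, #|[set x in X | f x == l]| = #|[set y in Y | g y == l]|) ->
  exists Psi : I -> I,
    [/\ {in X &, injective Psi}, Psi @: X = Y & {in X, forall x, g (Psi x) = f x}].
Proof.
move=> cardXY.
pose Xf l := enum [set x in X | f x == l]; pose Yf l := enum [set y in Y | g y == l].
have sz l : size (Xf l) = size (Yf l) by rewrite -!cardE cardXY.
(* Fibres are matched in order of enumeration; on [X] the default [x] is never reached, since the
   fibres have equal size. *)
pose Psi x := nth x (Yf (f x)) (index x (Xf (f x))).
have ltx x : x \in X -> (index x (Xf (f x)) < size (Yf (f x)))%N.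
  by move=> xX; rewrite -sz index_mem mem_enum inE xX eqxx.
have PsiY x : x \in X -> (Psi x \in Y) && (g (Psi x) == f x).
  by move=> xX; have := mem_nth x (ltx x xX); rewrite mem_enum inE.
exists Psi; have inj : {in X &, injective Psi}.
  move=> x x' xX x'X e.
  have ef : f x = f x'.
    by have /andP[_ /eqP <-] := PsiY x xX; have /andP[_ /eqP <-] := PsiY x' x'X; rewrite e.
  move: e; rewrite /Psi -ef (set_nth_default x x'); last by rewrite ef ltx.
  move/eqP; rewrite nth_uniq ?enum_uniq ?ltx //; last by rewrite ef ltx.
  move/eqP/(congr1 (nth x (Xf (f x)))).
  by rewrite !nth_index // mem_enum inE ?xX ?x'X ?ef eqxx.
split=> //; last by move=> x /PsiY/andP[_ /eqP].
apply/eqP; rewrite eqEcard; apply/andP; split.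
  by apply/subsetP => _ /imsetP[x xX ->]; case/andP: (PsiY x xX).
rewrite card_in_imset //.
(* The type [L] need not be finite, so the sum runs over a list containing the labels that occur. *)
have fib (Z : {set I}) (h : I -> L) (s : seq L) : uniq s -> {in Z, forall x, h x \in s} ->
    #|Z| = (\sum_(l <- s) #|[set x in Z | h x == l]|)%N.
  move=> us hs; rewrite -sum1_card.
  under [RHS]eq_bigr => l _ do rewrite -sum1_card.
  under [RHS]eq_bigr => l _ do (under eq_bigl => x do rewrite inE; rewrite big_mkcondr /=).
  rewrite exchange_big /=; apply: eq_bigr => x xZ.
  rewrite (bigD1_seq (h x)) ?hs //= eqxx big1 // => l; rewrite eq_sym.
  by move/negbTE->.
pose s := undup ([seq f x | x in X] ++ [seq g y | y in Y]).
have us : uniq s by exact: undup_uniq.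
rewrite (fib X f s) // ?(fib Y g s) //; first by under eq_bigr => l _ do rewrite -cardXY.
  by move=> x xX; rewrite mem_undup mem_cat (image_f g xX) orbT.
by move=> x xX; rewrite mem_undup mem_cat (image_f f xX).
Qed.

Lemma sum_Xn_card (I : finType) (P : pred I) (d : I -> nat) k :
  (\sum_(x | P x) ('X^(d x) : {poly int}))`_k = #|[set x | P x & d x == k]|%:R.
Proof.
rewrite coef_sum -sum1_card natr_sum big_mkcond [RHS]big_mkcond /=.
apply: eq_bigr => x _; rewrite coefXn inE eq_sym.
by case: (P x) => //=; case: eqP.
Qed.

(** In the fraction field of the integer polynomials, with [t] the indeterminate, [t], [1 + t] and 2
    are nonzero. The embedding is injective, so the identity descends to polynomials. *)
Lemma ballot_odd_gf n (T : {set 'I_n * {set 'I_n}}) :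
  \sum_(p : {perm 'I_n} | (p \in ballot_set n) && (T \subset PEAK p)) ('X^(des p) : {poly int})
  = \sum_(s : {perm 'I_n} | (s \in odd_set n) && (T \subset cPEAK s)) 'X^(exct s).
Proof.
pose frac := @FracField.tofrac {poly int}.
have nz q : q != 0 -> frac q != 0 by rewrite tofrac_eq0.
apply/eqP; rewrite -tofrac_eq !rmorph_sum /=; apply/eqP.
under eq_bigr do rewrite rmorphXn /=.
under [RHS]eq_bigr do rewrite rmorphXn /=.
rewrite ballot_gf odd_gf perm_sum_ballot_sum //.
- by apply: nz; rewrite polyX_eq0.
- rewrite -tofrac1 -tofracD; apply: nz; apply/eqP => /(congr1 (fun q : {poly int} => q.[0])).
  by rewrite !hornerE.
- rewrite -tofrac1 -tofracMn; apply: nz.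
  by apply/eqP => /(congr1 (fun q : {poly int} => q.[0])); rewrite !hornerE.
Qed.

Theorem theorem1p3 (n : nat) (hn : (0 < n)%N) :
  exists Psi : {perm 'I_n} -> {perm 'I_n},
    [/\ {in ballot_set n &, injective Psi},
        Psi @: ballot_set n = odd_set n,
        (forall p, p \in ballot_set n ->
           des p = exct (Psi p) /\ PEAK p = cPEAK (Psi p)) &
        \sum_(p in ballot_set n) ('X^(des p) : {poly int})
          = \sum_(s in odd_set n) 'X^(exct s)].
Proof.
have fibers := superset_sum_inj (@ballot_odd_gf n).
(* The label pairs the descent number with the peak set; the size of a fibre is a coefficient of the
   identity for that exact peak set. *)
have [|Psi [injP imP statP]] := @fiber_bijection _ _ (ballot_set n) (odd_set n)
    (fun p => (des p, PEAK p)) (fun s => (exct s, cPEAK s)).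
  move=> [d T]; have /(congr1 (fun q : {poly int} => q`_d)) := fibers T.
  rewrite !sum_Xn_card => /eqP; rewrite eqr_nat => /eqP cardE.
  transitivity #|[set x | (x \in ballot_set n) && (PEAK x == T) & des x == d]|.
    by apply: eq_card => x; rewrite !inE xpair_eqE [X in _ && X]andbC andbA.
  rewrite cardE.
  by apply: eq_card => x; rewrite !inE xpair_eqE [X in _ = _ && X]andbC andbA.
have stat p : p \in ballot_set n -> des p = exct (Psi p) /\ PEAK p = cPEAK (Psi p).
  by move=> /statP[-> ->].
exists Psi; split=> //.
rewrite -imP big_imset //=; apply: eq_bigr => p pB.
by have [-> _] := stat p pB.
Qed.
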